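(* Let $1\le r\le n-1$ with $\gcd(r,n)=1$. Put $a_0=0$, $a_i=\lceil ni/r\rceil$ and $c_i=ra_i-ni$ for $1\le i\le r$. Let $l_1,\dots,l_{r-1}$ be integers with $a_{i-1}+2\le l_i\le a_i$ for $1\le i\le r-1$, and put $w=(a_1,\dots,a_r)$ and $v_{\underline l}=(1,l_1,\dots,l_{r-1})$ in $I(r,n)$. Then the GIT quotient $T\backslash\!\backslash (X^{v_{\underline l}}_{w})^{ss}_T(\mathcal{L}(n\omega_r))$ of the Richardson variety $X^{v_{\underline l}}_w\subseteq G_{r,n}$ is isomorphic to $\mathbb{P}^{a_1-l_1}\times\mathbb{P}^{a_2-l_2}\times\cdots\times\mathbb{P}^{a_{r-1}-l_{r-1}}$, and it is embedded via the very ample line bundle $\mathcal{O}_{\mathbb{P}^{a_1-l_1}}(c_1)\boxtimes\mathcal{O}_{\mathbb{P}^{a_2-l_2}}(c_2)\boxtimes\cdots\boxtimes\mathcal{O}_{\mathbb{P}^{a_{r-1}-l_{r-1}}}(c_{r-1})$; that is, the isomorphism is one of polarized varieties, where the GIT quotient is polarized by the descent of $\mathcal{L}(n\omega_r)$ and the product of projective spaces by the line bundle above.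
   Context: $G_{r,n}$ is the Grassmannian of $r$-dimensional subspaces of $\mathbb{C}^n$, embedded in $\mathbb{P}(\wedge^r\mathbb{C}^n)$ by the Plücker embedding; $T\subset SL(n,\mathbb{C})$ is the maximal torus of diagonal matrices, acting on $G_{r,n}$ through its natural action on $\mathbb{C}^n$. $\mathcal{L}(\omega_r)$ is the ample line bundle on $G_{r,n}$ associated to the fundamental weight $\omega_r$ (the pullback of $\mathcal{O}(1)$ under the Plücker embedding) with its natural $T$-linearization, and $\mathcal{L}(n\omega_r)=\mathcal{L}(\omega_r)^{\otimes n}$; the same symbols denote restrictions to subvarieties. $I(r,n)=\{\alpha=(\alpha_1,\dots,\alpha_r): 1\le\alpha_1<\cdots<\alpha_r\le n\}$, ordered componentwise. With $e_1,\dots,e_n$ the standard basis of $\mathbb{C}^n$, let $V_t=\langle e_1,\dots,e_t\rangle$ and $V^t=\langle e_n,\dots,e_{n-t+1}\rangle$. For $\alpha,\beta\in I(r,n)$ put $X_\alpha=\{U\in G_{r,n}:\dim(U\cap V_{\alpha_t})\ge t,\ 1\le t\le r\}$ (Schubert variety), $X^\beta=\{U\in G_{r,n}:\dim(U\cap V^{n-\beta_{r-t+1}+1})\ge t,\ 1\le t\le r\}$ (opposite Schubert variety), and $X^\beta_\alpha=X^\beta\cap X_\alpha$ (Richardson variety). $(X)^{ss}_T(\mathcal{L})$ is the set of semistable points of $X$ for the $T$-linearized bundle $\mathcal{L}$. The line bundle $\mathcal{L}(n\omega_r)$ descends to the GIT quotient of $G_{r,n}$ by $T$ (hence to that of $X^{v_{\underline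 l}}_w$), and $T\backslash\!\backslash (X^{v_{\underline l}}_{w})^{ss}_T(\mathcal{L}(n\omega_r))=\mathrm{Proj}(R)$, with $R=\bigoplus_{d\ge0}R_d$ and $R_d=H^0(X^{v_{\underline l}}_w,\mathcal{L}(n\omega_r)^{\otimes d})^T$. An empty product of projective spaces (case $r=1$) is a point. *)

(* Defs.v *)
From HB Require Import structures.
From mathcomp Require Import all_boot all_order all_algebra.
From mathcomp Require Import boolp classical_sets.

Set Implicit Arguments.
Unset Strict Implicit.
Unset Printing Implicit Defensive.

Import GRing.Theory.

Local Open Scope classical_set_scope.
Local Open Scope ring_scope.

(* A (quasi-)projective variety over the algebraically closed field [K] is
   given by the set of its coordinate vectors: two coordinate vectors may
   represent the same point ([same_pt]), and [homog d] is the set of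
   homogeneous functions of degree [d] of the coordinates.  Degrees live in an
   arbitrary commutative monoid, so that products of projective spaces are
   covered (multidegrees).  Sets of points are sets of coordinate vectors, and
   maps between varieties are maps on coordinate vectors compatible with
   [same_pt]. *)

Record variety (K : closedFieldType) (D : nmodType) := Variety {
  coords :> Type;
  same_pt : coords -> coords -> Prop;
  homog : D -> set (coords -> K)
}.

Section Varieties.
Variable K : closedFieldType.

(* The Zariski topology, with basis the non-vanishing loci of homogeneous
   functions. *)
Definition zopen (D : nmodType) (X : variety K D) (U : set X) : Prop :=
  forall x, U x -> exists (d : D) (f : X -> K),
    [/\ homog d f, f x != 0 & [set y | f y != 0] `<=` U].

(* [twist d U s]: [s] restricts to a section of O(d) over [U], i.e. it is
   locally a quotient [f / g] of homogeneous functions of degrees [e + d] and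
   [e]; only the values of [s] on [U] matter. *)
Definition twist (D : nmodType) (X : variety K D) (d : D)
    (U : set X) (s : X -> K) : Prop :=
  forall x, U x -> exists V : set X, [/\ zopen V, V x, V `<=` U &
    exists (e : D) (f g : X -> K),
      [/\ homog (e + d) f, homog e g & forall y, V y -> g y != 0 /\ s y = f y / g y]].

Definition regular (D : nmodType) (X : variety K D) : set X -> (X -> K) -> Prop :=
  twist 0.

Definition is_morphism (DX DY : nmodType) (X : variety K DX) (Y : variety K DY)
    (f : X -> Y) : Prop :=
  [/\ forall x x', same_pt x x' -> same_pt (f x) (f x'),
      forall V : set Y, zopen V -> zopen (f @^-1` V) &
      forall (V : set Y) (s : Y -> K), zopen V ->
        regular V s -> regular (f @^-1` V) (s \o f)].

Definition is_isomorphism (DX DY : nmodType) (X : variety K DX)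
    (Y : variety K DY) (f : X -> Y) (g : Y -> X) : Prop :=
  [/\ is_morphism f, is_morphism g,
      forall x, same_pt (g (f x)) x & forall y, same_pt (f (g y)) y].

Definition subvariety (D : nmodType) (X : variety K D) (P : set X) : variety K D :=
  @Variety K D {x : X | P x}
    (fun x y => same_pt (sval x) (sval y))
    (fun d => [set f | exists2 F, homog d F & f = F \o sval]).

(* A line bundle on [X] is given by its sections over the open sets; a section
   over [U] is written as a scalar function on [U] by means of a trivialization
   of the fibre at each coordinate vector.  The bundle O(d) is [twist d], the
   fibre at a coordinate vector being trivialized by this vector. *)

Definition line_bundle (D : nmodType) (X : variety K D) : Type :=
  set X -> (X -> K) -> Prop.

(* Isomorphisms are fibrewise multiplications by nonzero scalars [u x]. *)
Definition is_lb_isomorphism (D : nmodType) (X : variety K D)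
    (M N : line_bundle X) (u : X -> K) : Prop :=
  (forall x, u x != 0) /\
  forall (U : set X) (s : X -> K), zopen U -> (M U s <-> N U (fun x => u x * s x)).

(* The fibre of [pullback f M] at [x] is that of [M] at [f x]; its sections are
   locally products of a regular function and the pullback of a section. *)
Definition pullback (DX DY : nmodType) (X : variety K DX) (Y : variety K DY)
    (f : X -> Y) (M : line_bundle Y) : line_bundle X :=
  fun U s => forall x, U x ->
    exists (W : set X) (V : set Y) (a : X -> K) (t : Y -> K),
      [/\ [/\ zopen W, W x & W `<=` U],
          zopen V /\ W `<=` f @^-1` V,
          regular W a, M V t &
          forall y, W y -> s y = a y * t (f y)].

Definition polarized_isomorphic (DX DY : nmodType)
    (X : variety K DX) (M : line_bundle X)
    (Y : variety K DY) (N : line_bundle Y) : Prop :=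
  exists (f : X -> Y) (g : Y -> X) (u : X -> K),
    is_isomorphism f g /\ is_lb_isomorphism M (pullback f N) u.

(* The graded algebra of functions generated by the functions [G d], placed in
   degree [d]. *)
Inductive generated (D : nmodType) (E : Type) (G : D -> set (E -> K)) :
    D -> (E -> K) -> Prop :=
  | gen_const c : generated G 0 (fun=> c)
  | gen_base d f : G d f -> generated G d f
  | gen_zero d : generated G d (fun=> 0)
  | gen_add d f g : generated G d f -> generated G d g ->
      generated G d (fun x => f x + g x)
  | gen_mul d e f g : generated G d f -> generated G e g ->
      generated G (d + e) (fun x => f x * g x).

Definition unit_degree (k : nat) (i : 'I_k) : {ffun 'I_k -> nat} :=
  [ffun j => nat_of_bool (j == i)].

(* P^(m 0) x ... x P^(m (k-1)), with multihomogeneous polynomials. *)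
Definition prod_proj (k : nat) (m : 'I_k -> nat) : variety K {ffun 'I_k -> nat} :=
  let E := {x : forall i : 'I_k, 'rV[K]_(m i).+1 | forall i, x i != 0} in
  @Variety K _ E
    (fun x y => forall i, exists2 c : K, c != 0 & sval y i = c *: sval x i)
    (generated (fun d => [set f | exists i (j : 'I_(m i).+1),
        d = unit_degree i /\ f = (fun x : E => sval x i 0 j)])).

Definition proj_space (N : nat) := prod_proj (fun _ : 'I_1 => N).

(* [M] is very ample: finitely many global sections without common zero define
   a closed immersion into projective space, i.e. an isomorphism onto a closed
   subvariety. *)
Definition very_ample (D : nmodType) (X : variety K D) (M : line_bundle X) : Prop :=
  exists (N : nat) (s : 'I_N.+1 -> X -> K) (f : X -> proj_space N),
    let image : set (proj_space N) := [set z | exists x, same_pt z (f x)] in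
    [/\ forall j, M setT (s j),
        forall x i, sval (f x) i = \row_j s j x,
        is_morphism f,
        zopen (~` image) &
        exists g : subvariety image -> X, is_morphism g /\
          forall z x, same_pt (sval z) (f x) -> same_pt (g z) x].

(* [R d] is the degree [d] part of a graded algebra, all [R d] consisting of
   functions on a set [E].  The coordinate vectors on Proj (the direct sum of
   the [R d]) are the [K]-points of Spec outside of the vertex, i.e. the
   [K]-algebra homomorphisms to [K] not vanishing identically in positive
   degrees; two of them give the same point when they differ by the action of
   the multiplicative group defined by the grading. *)

Section Proj.
Variables (E : Type) (R : nat -> set (E -> K)).

Record proj_coords := ProjCoords {
  proj_eval :> nat -> (E -> K) -> K;
  _ : proj_eval 0 (fun=> 1) = 1;
  _ : forall d (c : K) f g, R d f -> R d g ->
        proj_eval d (fun x => c * f x + g x) = c * proj_eval d f + proj_eval d g;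
  _ : forall d e f g, R d f -> R e g ->
        proj_eval (d + e) (fun x => f x * g x) = proj_eval d f * proj_eval e g;
  _ : exists d f, [/\ (0 < d)%N, R d f & proj_eval d f != 0]
}.

Definition Proj : variety K nat :=
  @Variety K nat proj_coords
    (fun p q => exists2 c : K, c != 0 &
       forall d f, R d f -> p d f = c ^+ d * q d f)
    (fun d => [set F | exists2 f, R d f & F = (fun p : proj_coords => p d f)]).

End Proj.

End Varieties.

Section Grassmannian.
Variables (K : closedFieldType) (r n : nat).

(* An [r]-dimensional subspace is the row space of a matrix [A] with linearly
   independent rows [A_1, ..., A_r].  The coordinate vector [A] stands for the
   Pluecker vector A_1 /\ ... /\ A_r, with coordinates the maximal minors of
   [A]; O(1), that is [twist 1], is therefore L(omega_r). *)
Definition grassmannian : variety K nat :=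
  let E := {A : 'M[K]_(r, n) | row_free A} in
  @Variety K nat E
    (fun A B => (sval A == sval B)%MS)
    (generated (fun d => [set f | d = 1%N /\
       exists t : 'I_r -> 'I_n, {homo t : i j / (i < j)%N} /\
         f = (fun A : E => \det (colsub t (sval A)))])).

(* V_t and V^t, as row spaces. *)
Definition flag (t : nat) : 'M[K]_n := pid_mx t.
Definition opp_flag (t : nat) : 'M[K]_n := copid_mx (n - t).

(* Elements of I(r,n) are given as functions [alpha] of which only the values
   alpha_1, ..., alpha_r matter. *)
Definition schubert (alpha : nat -> nat) : set grassmannian :=
  [set A | forall t, (1 <= t <= r)%N ->
     (t <= \rank (sval A :&: flag (alpha t))%MS)%N].

Definition opp_schubert (beta : nat -> nat) : set grassmannian :=
  [set A | forall t, (1 <= t <= r)%N ->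
     (t <= \rank (sval A :&: opp_flag (n - beta (r - t + 1) + 1)%N)%MS)%N].

Definition richardson (beta alpha : nat -> nat) : set grassmannian :=
  opp_schubert beta `&` schubert alpha.

Definition torus : set 'rV[K]_n := [set t | \prod_j t 0 j = 1].

Section Quotient.
Variable P : set grassmannian.
Let X := subvariety P.

Definition torus_acts (t : 'rV[K]_n) (A B : grassmannian) : Prop :=
  sval B = sval A *m diag_mx t.

(* H^0(X, L(n omega_r)^d)^T: the line bundle L(n omega_r)^d is O(n d), and the
   natural linearization makes [T] act on its sections by translation. *)
Definition inv_sections (d : nat) : set (X -> K) :=
  [set s | twist (n * d)%N setT s /\
     forall t (x y : X), torus t -> torus_acts t (sval x) (sval y) -> s y = s x].

Definition semistable : set X :=
  [set x | exists d s, [/\ (0 < d)%N, inv_sections d s & s x != 0]].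

Definition ss_locus : variety K nat := subvariety semistable.

Definition git_quotient : variety K nat := Proj inv_sections.

Definition quotient_map (x : ss_locus) : git_quotient :=
  @ProjCoords K X inv_sections (fun _ s => s (sval x))
    erefl (fun _ _ _ _ _ _ => erefl) (fun _ _ _ _ _ _ => erefl) (svalP x).

(* The line bundle [M] on the quotient is the descent of [L]: there is a
   [T]-equivariant isomorphism from the pullback of [M] to [L] on the
   semistable locus.  Equivariance means that the pullbacks of sections of [M]
   correspond to [T]-invariant sections of [L]. *)
Definition is_descent (L : line_bundle ss_locus) (M : line_bundle git_quotient) : Prop :=
  exists u : ss_locus -> K,
    is_lb_isomorphism (pullback quotient_map M) L u /\
    forall (V : set git_quotient) (s : git_quotient -> K), zopen V -> M V s ->
      forall t (x y : ss_locus), torus t ->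
        torus_acts t (sval (sval x)) (sval (sval y)) ->
        V (quotient_map x) -> V (quotient_map y) ->
        u y * s (quotient_map y) = u x * s (quotient_map x).

End Quotient.
End Grassmannian.

Definition ceil_div (m d : nat) : nat := ((m + d.-1) %/ d)%N.

Section Numbers.
Variables r n : nat.

Definition a_ (i : nat) : nat := ceil_div (n * i) r.

Definition c_ (i : nat) : nat := (r * a_ i - n * i)%N.

(* (1, l_1, ..., l_(r-1)) *)
Definition v_ (l : nat -> nat) (t : nat) : nat :=
  if t == 1%N then 1%N else l t.-1.

End Numbers.

(* Main.v *)
(** By the numerical criterion, a subspace [U] in the Richardson variety is
    semistable only if it has a basis [u_1, ..., u_r] with [u_i] supported in the
    columns [l_(i-1), ..., a_i] (where [l_0 = 1]), with nonzero entries in the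
    columns [a_(i-1) + 1, ..., a_i] and some nonzero entry in the columns
    [l_(i-1), ..., a_(i-1)] shared with [u_(i-1)].  The torus and the rescaling
    of the [u_i] make the entries in the columns [a_(i-1) + 1, ..., a_i] equal to
    1, and the shared entries, up to one scalar for each [i], are a point of
    [P^(a_1 - l_1) x ... x P^(a_(r-1) - l_(r-1))].

    Thus invariant sections are determined by their restriction to a slice,
    an affine space of matrices.  The residual scalings make the restriction of a
    section of degree [d] semi-invariant, of multidegree [d * (c_1, ..., c_(r-1))],
    and being regular at the origin it is a multihomogeneous polynomial.
    Conversely each monomial of multidegree [(c_1, ..., c_(r-1))] is the restriction
    of a product of [n] maximal minors, read off from the columns of a tableau
    in which every index occurs [r] times.  Hence the ring of invariants is the
    section ring of [O(c_1, ..., c_(r-1))], and the quotient is identified with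
    the product of projective spaces through the Segre-Veronese embedding. *)

Require Import Defs.
From HB Require Import structures.
From mathcomp Require Import all_boot all_order all_algebra.
From mathcomp Require Import boolp classical_sets reals complex.
From mathcomp Require Import perm zify ring.

Set Implicit Arguments.
Unset Strict Implicit.
Unset Printing Implicit Defensive.
Import GRing.Theory.
Local Open Scope classical_set_scope.
Local Open Scope ring_scope.

(** * Varieties and line bundles *)

Section GradedVarieties.
Variable K : closedFieldType.

(** Sections are only local quotients of homogeneous functions, so the ring of invariants comes
    without generators. What makes it computable is that an invariant section lives on the whole
    Richardson variety: the origin of the slice is not semistable when [r > 1], yet a section is
    regular there, and the residual scalings contract the slice to this point. Points of the
    quotient are abstract algebra homomorphisms on the ring of invariants. They are recovered from
    their values on the degree 1 sections that restrict to monomials: these values satisfy the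
    equations of the Segre-Veronese variety, and solving the equations gives a point of the product.
    The inverse map evaluates sections at slice matrices. Coprimality enters as [c_i > 0] for
    [0 < i < r], that is [r * a_i > n * i]. It forces the shared entries of a semistable point to be
    nonzero in each row, and it makes the bundle on the product very ample. The numerical criterion
    is proved as a necessary condition; conversely, slice points with nonzero shared vectors are
    semistable because some monomial does not vanish there. *)

Record graded (D : nmodType) (X : variety K D) : Prop := Graded {
  homog1 : homog (0 : D) (fun _ : X => 1);
  homogM : forall (d e : D) (f g : X -> K), homog d f -> homog e g ->
    homog (d + e) (fun x => f x * g x);
  homog_pt : forall x y : X, same_pt x y -> exists chi : D -> K,
    (forall d, chi d != 0) /\ forall d (f : X -> K), homog d f -> f y = chi d * f x
}.

Section OneVariety.
Variables (D : nmodType) (X : variety K D).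
Hypothesis gX : graded X.

Lemma zopen_homog d (f : X -> K) : homog d f -> zopen [set x | f x != 0].
Proof. by move=> hf x fx; exists d, f; split. Qed.

Lemma zopenT : zopen [set: X].
Proof. by move=> x _; exists 0, (fun=> 1); split=> //; [exact: homog1|exact: oner_neq0]. Qed.

Lemma zopenI (U V : set X) : zopen U -> zopen V -> zopen (U `&` V).
Proof.
move=> oU oV x [Ux Vx].
have [d [f [hf fx fU]]] := oU x Ux; have [e [g [hg gx gV]]] := oV x Vx.
exists (d + e), (fun x => f x * g x); split; first exact: homogM.
  by rewrite mulf_neq0.
by move=> y /=; rewrite mulf_eq0 negb_or => /andP[fy gy]; split; [exact: fU|exact: gV].
Qed.

Lemma zopen_local (U : set X) :
  (forall x, U x -> exists W : set X, [/\ zopen W, W x & W `<=` U]) -> zopen U.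
Proof.
move=> H x Ux; have [W [oW Wx WU]] := H x Ux.
have [d [f [hf fx fW]]] := oW x Wx; exists d, f; split=> //.
exact: subset_trans WU.
Qed.

Lemma twist_homog d (U : set X) (f : X -> K) : zopen U -> homog d f -> twist d U f.
Proof.
move=> oU hf x Ux; exists U; split=> //; exists 0, f, (fun=> 1).
rewrite add0r; split=> //; first exact: homog1.
by move=> y _; rewrite oner_neq0 divr1.
Qed.

Lemma twistM d e (U : set X) (s t : X -> K) : twist d U s -> twist e U t ->
  twist (d + e) U (fun x => s x * t x).
Proof.
move=> hs ht x Ux.
have [V [oV Vx VU [a [f [g [hf hg E]]]]]] := hs x Ux.
have [V' [oV' Vx' VU' [a' [f' [g' [hf' hg' E']]]]]] := ht x Ux.
exists (V `&` V'); split=> //; first exact: zopenI.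
  by move=> y [/VU].
exists (a + a'), (fun x => f x * f' x), (fun x => g x * g' x); split.
- by rewrite addrACA; exact: homogM.
- exact: homogM.
- move=> y [/E[gy ->] /E'[gy' ->]]; rewrite mulf_neq0 //; split=> //.
  by rewrite invfM mulrACA.
Qed.

Lemma twistV d e (U : set X) (s t : X -> K) : twist (d + e) U s -> twist e U t ->
  (forall x, U x -> t x != 0) -> twist d U (fun x => s x / t x).
Proof.
move=> hs ht t0 x Ux.
have [V [oV Vx VU [a [f [g [hf hg E]]]]]] := hs x Ux.
have [V' [oV' Vx' VU' [a' [f' [g' [hf' hg' E']]]]]] := ht x Ux.
exists (V `&` V'); split=> //; first exact: zopenI.
  by move=> y [/VU].
exists (a + (a' + e)), (fun x => f x * g' x), (fun x => g x * f' x); split.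
- have -> : a + (a' + e) + d = a + (d + e) + a'.
    by rewrite -!addrA; congr (_ + _); rewrite addrC [e + d]addrC addrA.
  exact: homogM.
- exact: homogM.
- move=> y [Vy Vy']; have [gy ->] := E _ Vy; have [gy' ey] := E' _ Vy'.
  have : t y != 0 by apply: t0; exact: VU.
  rewrite ey mulf_eq0 invr_eq0 negb_or => /andP[fy' _].
  rewrite mulf_neq0 //; split=> //; field.
  by rewrite gy gy' fy'.
Qed.

Lemma twistW d (U V : set X) (s : X -> K) : twist d U s -> zopen V -> V `<=` U -> twist d V s.
Proof.
move=> hs oV VU x Vx.
have [V' [oV' Vx' VU' [a [f [g [hf hg E]]]]]] := hs x (VU _ Vx).
exists (V' `&` V); split; [exact: zopenI|by []| by move=> y []|].
by exists a, f, g; split=> // y [/E].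
Qed.

Lemma twist_local d (U : set X) (s : X -> K) :
  (forall x, U x -> exists W : set X, [/\ zopen W, W x, W `<=` U & twist d W s]) ->
  twist d U s.
Proof.
move=> H x Ux; have [W [oW Wx WU hs]] := H x Ux.
have [V [oV Vx VW E]] := hs x Wx; exists V; split=> //; exact: subset_trans WU.
Qed.

Lemma twist_eq d (U : set X) (s t : X -> K) :
  (forall x, U x -> s x = t x) -> twist d U s -> twist d U t.
Proof.
move=> st hs x Ux; have [V [oV Vx VU [a [f [g [hf hg E]]]]]] := hs x Ux.
exists V; split=> //; exists a, f, g; split=> // y Vy.
by rewrite -st; [exact: E|exact: VU].
Qed.

Lemma zopen_twist d (U : set X) (s : X -> K) :
  twist d U s -> zopen [set x | U x /\ s x != 0].
Proof.
move=> hs; apply: zopen_local => x [Ux sx].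
have [V [oV Vx VU [a [f [g [hf hg E]]]]]] := hs x Ux.
exists (V `&` [set y | f y != 0]); split.
- by apply: zopenI => //; exact: zopen_homog hf.
- split=> //=; have [gx ex] := E x Vx.
  by apply: contraNneq sx => fx; rewrite ex fx mul0r.
- move=> y [Vy /= fy]; split; first exact: VU.
  by have [gy ->] := E y Vy; rewrite mulf_neq0 ?invr_eq0.
Qed.

(** [x] and [y] need not represent the same point: homogeneous functions differ at them by a
    character, so no open set separates them. The descent applies this to torus translates, with
    [chi = 1]. *)
Lemma twist_scale d (U : set X) (s : X -> K) (chi : D -> K) x y :
  (forall d, chi d != 0) -> (forall d e, chi (d + e) = chi d * chi e) ->
  (forall d (f : X -> K), homog d f -> f y = chi d * f x) ->
  twist d U s -> U x -> s y = chi d * s x.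
Proof.
move=> chi0 chiD H hs Ux.
have [V [oV Vx VU [a [f [g [hf hg E]]]]]] := hs x Ux.
have Vy : V y.
  have [b [h [hh hx hV]]] := oV x Vx.
  by apply: hV => /=; rewrite (H _ _ hh) mulf_neq0.
have [_ ->] := E _ Vy; have [gx ->] := E _ Vx.
by rewrite (H _ _ hf) (H _ _ hg) chiD invfM mulrACA [chi a * _]mulrC mulfK // mulrA.
Qed.

End OneVariety.

Lemma graded_sub (D : nmodType) (X : variety K D) (P : set X) :
  graded X -> graded (subvariety P).
Proof.
move=> gX; split.
- by exists (fun=> 1) => //; exact: homog1.
- move=> d e _ _ [f hf ->] [g hg ->]; exists (fun x => f x * g x) => //; exact: homogM.
- move=> x y /(homog_pt gX)[chi [chi0 H]]; exists chi; split=> // d _ [f hf ->] /=.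
  exact: H.
Qed.

Section Morphisms.
Variables (DX DY : nmodType) (X : variety K DX) (Y : variety K DY).
Hypotheses (gX : graded X) (gY : graded Y).

(* [chi] absorbs the difference between the coordinate vector [f x] and a
   local homogeneous expression for the same point. *)
Lemma morphism_local (f : X -> Y) :
  (forall x x', same_pt x x' -> same_pt (f x) (f x')) ->
  (forall x0, exists (W : set X) (phi : DY -> DX) (chi : X -> DY -> K),
     [/\ zopen W, W x0, forall x e, W x -> chi x e != 0 &
      forall e (h : Y -> K), homog e h -> exists h' : X -> K,
        twist (phi e) W h' /\ forall x, W x -> h (f x) = chi x e * h' x]) ->
  is_morphism f.
Proof.
move=> fpt H.
have cont (V : set Y) : zopen V -> zopen (f @^-1` V).
  move=> oV; apply: (@zopen_local _ X) => x0 Vx0.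
  have [W [phi [chi [oW Wx0 chi0 HW]]]] := H x0.
  have [e [h [hh hx hV]]] := oV _ Vx0.
  have [h' [th' E]] := HW _ _ hh.
  exists [set x | W x /\ h' x != 0]; split.
  - exact: zopen_twist th'.
  - by split=> //; move: hx; rewrite E // mulf_eq0 negb_or => /andP[].
  - by move=> x [Wx hx']; apply: hV => /=; rewrite E // mulf_neq0 // chi0.
split=> // V s oV rs; apply: (@twist_local _ X) => x0 Vx0.
have [W [phi [chi [oW Wx0 chi0 HW]]]] := H x0.
have [V' [oV' Vx' VV' [e [F [G [hF hG E]]]]]] := rs _ Vx0.
rewrite addr0 in hF.
have [F' [tF EF]] := HW _ _ hF; have [G' [tG EG]] := HW _ _ hG.
have oWV : zopen (W `&` f @^-1` V') by apply: zopenI => //; exact: cont.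
exists (W `&` f @^-1` V'); split=> //.
  by move=> y [_ /VV'].
have G0 x : (W `&` f @^-1` V') x -> G' x != 0.
  move=> [Wx Vx]; have [] := E _ Vx; rewrite EG // mulf_eq0 negb_or.
  by case/andP.
apply: (@twist_eq _ X _ _ (fun x => F' x / G' x)).
  move=> x [Wx Vx] /=; have [_ ->] := E _ Vx; rewrite EF // EG // invfM mulrACA.
  by rewrite divff ?mul1r // chi0.
apply: (@twistV _ X gX _ (phi e)) => //; first rewrite add0r.
  by apply: (twistW gX tF) => // y [].
by apply: (twistW gX tG) => // y [].
Qed.

(** [s] and [sg] are matching local frames around [f x] and [x]. Dividing by them turns sections of
    both bundles into regular functions, which pull back along the morphism [f]. *)
Lemma lb_isomorphism (f : X -> Y) (u : X -> K) (d : DX) (e : DY) :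
  is_morphism f -> (forall x, u x != 0) ->
  (forall x, exists (sg : X -> K) (s : Y -> K), [/\ twist d setT sg, homog e s,
     forall y, u y * s (f y) = sg y & sg x != 0]) ->
  is_lb_isomorphism (pullback f (twist e)) (twist d) u.
Proof.
move=> [fpt fcont freg] u0 H; split=> // U s oU; split.
- move=> hs; apply: (@twist_local _ X) => x Ux.
  have [sg [s0 [tsg hs0 E sgx]]] := H x.
  have [W [V [a [t [[oW Wx WU] [oV WV] ra tt Es]]]]] := hs x Ux.
  pose V' := V `&` [set y | s0 y != 0].
  have oV' : zopen V' by apply: zopenI => //; exact: zopen_homog hs0.
  pose W' := W `&` f @^-1` V'.
  have oW' : zopen W' by apply: zopenI => //; exact: fcont.
  have W'W : W' `<=` W by move=> y [].
  exists W'; split=> //.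
  + split=> //; split=> /=; first exact: WV.
    by apply: contraNneq sgx => s0x; rewrite -E s0x mulr0.
  + exact: subset_trans WU.
  have rt : regular V' (fun y => t y / s0 y).
    apply: (@twistV _ Y gY _ e); last by move=> y [].
      by rewrite add0r; apply: (twistW gY tt) => // y [].
    exact: (@twist_homog _ Y).
  have rf : regular W' (fun y => t (f y) / s0 (f y)).
    by apply: (twistW gX (freg _ _ oV' rt)) => // y [].
  have := twistM gX (twistM gX (twistW gX ra oW' W'W) rf) (twistW gX tsg oW' (@subsetT _ _)).
  rewrite !add0r; apply: (@twist_eq _ X) => y [Wy [_ /= s0y]].
  by rewrite -E Es //; field.
- move=> hs x Ux; have [sg [s0 [tsg hs0 E sgx]]] := H x.
  pose W := U `&` [set y | [set: X] y /\ sg y != 0].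
  have oW : zopen W by apply: zopenI => //; exact: zopen_twist tsg.
  have s0E y : W y -> s0 (f y) != 0.
    by move=> [_ [_ sgy]]; apply: contraNneq sgy => s0y; rewrite -E s0y mulr0.
  exists W, [set y | s0 y != 0], (fun x => u x * s x / sg x), s0; split.
  + by split=> // y [].
  + by split; [exact: zopen_homog hs0|].
  + apply: (@twistV _ X gX _ d); last by move=> y [_ []].
      by rewrite add0r; apply: (twistW gX hs) => // y [].
    exact: (twistW gX tsg).
  + by apply: twist_homog => //; exact: zopen_homog hs0.
  + move=> y Wy; rewrite -E; field.
    by rewrite u0 s0E.
Qed.

End Morphisms.

Lemma twistD (D : nmodType) (X : variety K D) d (U : set X) (s t : X -> K) :
  graded X -> (forall d (f g : X -> K), homog d f -> homog d g -> homog d (fun x => f x + g x)) ->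
  twist d U s -> twist d U t -> twist d U (fun x => s x + t x).
Proof.
move=> gX hD hs ht x Ux.
have [V [oV Vx VU [a [f [g [hf hg E]]]]]] := hs x Ux.
have [V' [oV' Vx' VU' [a' [f' [g' [hf' hg' E']]]]]] := ht x Ux.
exists (V `&` V'); split=> //; first exact: zopenI.
  by move=> y [/VU].
exists (a + a'), (fun x => f x * g' x + f' x * g x), (fun x => g x * g' x); split.
- apply: hD; first by rewrite addrAC; exact: homogM.
  by rewrite -addrA addrC; exact: homogM.
- exact: homogM.
- move=> y [/E[gy ->] /E'[gy' ->]]; rewrite mulf_neq0 //; split=> //.
  by field; rewrite gy gy'.
Qed.

Lemma twist_sub (D : nmodType) (X : variety K D) (P : set X) d (s : X -> K) :
  graded X -> twist d setT s -> twist d setT (fun x : subvariety P => s (sval x)).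
Proof.
move=> gX hs x _; have [V [oV Vx _ [a [f [g [hf hg E]]]]]] := hs (sval x) I.
exists (sval @^-1` V : set (subvariety P)); split=> //.
  move=> y Vy; have [e [h [hh hy hV]]] := oV _ Vy.
  exists e, (h \o sval); split=> //; first by exists h.
  by move=> z /= /hV.
exists a, (f \o sval), (g \o sval); split; [by exists f|by exists g|].
by move=> y Vy; exact: E.
Qed.

Lemma morphism_comp (DX DY DZ : nmodType) (X : variety K DX) (Y : variety K DY)
    (Z : variety K DZ) (f : X -> Y) (g : Y -> Z) :
  is_morphism f -> is_morphism g -> is_morphism (g \o f).
Proof.
move=> [f1 f2 f3] [g1 g2 g3]; split.
- by move=> x x' /f1 /g1.
- by move=> V /g2 /f2.
- by move=> V s oV rs; exact: (f3 _ _ (g2 _ oV) (g3 _ _ oV rs)).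
Qed.

Lemma lb_isomorphism_inv (D : nmodType) (X : variety K D) (M N : line_bundle X) u :
  is_lb_isomorphism M N u -> is_lb_isomorphism N M (fun x => (u x)^-1).
Proof.
move=> [u0 H]; split; first by move=> x; rewrite invr_eq0.
move=> U s oU; rewrite (H U _ oU).
by under [X in _ <-> N U X]eq_fun do rewrite mulrA divff // mul1r.
Qed.

End GradedVarieties.

(** * Multihomogeneous functions and gradings *)

Section Generated.
Variable K : closedFieldType.

(** [C] is any graded class closed under the algebra operations; it need not be of the form
    [generated], as with the homogeneous functions on a [Proj]. *)
Lemma generated_comp (D D' : nmodType) (E E' : Type) (G : D -> set (E -> K))
    (h : E' -> E) (phi : D -> D') (C : D' -> (E' -> K) -> Prop) :
  phi 0 = 0 -> {morph phi : d e / d + e} ->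
  (forall c, C 0 (fun=> c)) -> (forall d, C d (fun=> 0)) ->
  (forall d f g, C d f -> C d g -> C d (fun x => f x + g x)) ->
  (forall d e f g, C d f -> C e g -> C (d + e) (fun x => f x * g x)) ->
  (forall d f, G d f -> C (phi d) (f \o h)) ->
  forall d f, generated G d f -> C (phi d) (f \o h).
Proof.
move=> p0 pD Cc C0 CD CM CG d f; elim=> {d f}.
- by move=> c; rewrite p0; exact: Cc.
- exact: CG.
- by move=> d; exact: C0.
- by move=> d f g _ IHf _ IHg; exact: CD.
- by move=> d e f g _ IHf _ IHg; rewrite pD; exact: CM.
Qed.

Lemma generated_sub (D D' : nmodType) (E E' : Type) (G : D -> set (E -> K))
    (G' : D' -> set (E' -> K)) (h : E' -> E) (phi : D -> D') :
  phi 0 = 0 -> {morph phi : d e / d + e} ->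
  (forall d f, G d f -> generated G' (phi d) (f \o h)) ->
  forall d f, generated G d f -> generated G' (phi d) (f \o h).
Proof.
move=> p0 pD; apply: generated_comp => //.
- exact: gen_const.
- exact: gen_zero.
- by move=> *; exact: gen_add.
- by move=> *; exact: gen_mul.
Qed.

Lemma generated_prod (D : nmodType) (E : Type) (G : D -> set (E -> K))
    (I : Type) (s : seq I) (P : pred I) (e : I -> D) (f : I -> E -> K) :
  (forall i, P i -> generated G (e i) (f i)) ->
  generated G (\sum_(i <- s | P i) e i) (fun x => \prod_(i <- s | P i) f i x).
Proof.
move=> H; elim: s => [|i s IH].
  rewrite big_nil; under [X in generated G _ X]eq_fun do rewrite big_nil; exact: gen_const.
rewrite big_cons; under [X in generated G _ X]eq_fun do rewrite big_cons; case Pi: (P i) => //.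
by apply: gen_mul => //; exact: H.
Qed.

Lemma generated_sum (D : nmodType) (E : Type) (G : D -> set (E -> K))
    (I : Type) (s : seq I) (P : pred I) d (f : I -> E -> K) :
  (forall i, P i -> generated G d (f i)) ->
  generated G d (fun x => \sum_(i <- s | P i) f i x).
Proof.
move=> H; elim: s => [|i s IH].
  under [X in generated G _ X]eq_fun do rewrite big_nil; exact: gen_zero.
under [X in generated G _ X]eq_fun do rewrite big_cons; case Pi: (P i) => //.
by apply: gen_add => //; exact: H.
Qed.

End Generated.

Section Multiprojective.
Variables (K : closedFieldType) (k : nat) (m : 'I_k -> nat).

(** Zero vectors are allowed, unlike in the coordinates of [prod_proj]: polynomials on the slice are
    evaluated at the origin. *)
Definition affine_space : Type := forall i : 'I_k, 'rV[K]_(m i).+1.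

Definition coord_fun (d : {ffun 'I_k -> nat}) : set (affine_space -> K) :=
  [set f | exists i (j : 'I_(m i).+1), d = unit_degree i /\ f = (fun x : affine_space => x i 0 j)].

Definition multihomog := generated coord_fun.

Lemma multihomog_homog d f : multihomog d f ->
  homog d (fun x : prod_proj K m => f (sval x)).
Proof.
move: d f; apply: (@generated_sub _ _ _ _ _ _ _ sval id) => // d _ [i [j [-> ->]]].
by apply: gen_base; exists i, j.
Qed.

Lemma homog_multihomog d (f : prod_proj K m -> K) : homog d f ->
  exists2 F, multihomog d F & f = (fun x => F (sval x)).
Proof.
elim=> {d f}.
- by move=> c; exists (fun=> c) => //; exact: gen_const.
- move=> d _ [i [j [-> ->]]]; exists (fun x : affine_space => x i 0 j) => //.
  by apply: gen_base; exists i, j.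
- by move=> d; exists (fun=> 0) => //; exact: gen_zero.
- move=> d _ _ _ [F hF ->] _ [G hG ->].
  by exists (fun x => F x + G x) => //; exact: gen_add.
- move=> d e _ _ _ [F hF ->] _ [G hG ->].
  by exists (fun x => F x * G x) => //; exact: gen_mul.
Qed.

Definition scale (lam : 'I_k -> K) (x : affine_space) : affine_space :=
  fun i => lam i *: x i.

Definition weight (lam : 'I_k -> K) (d : {ffun 'I_k -> nat}) : K :=
  \prod_i lam i ^+ d i.

Lemma weight0 lam : weight lam 0 = 1.
Proof. by rewrite /weight big1 // => i _; rewrite ffunE expr0. Qed.

Lemma weightD lam : {morph weight lam : d e / d + e >-> d * e}.
Proof. by move=> d e; rewrite -big_split; apply: eq_bigr => i _; rewrite ffunE exprD. Qed.

Lemma weight_unit lam i : weight lam (unit_degree i) = lam i.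
Proof.
rewrite /weight (bigD1 i) //= !ffunE eqxx expr1 big1 ?mulr1 //.
by move=> i' ne; rewrite ffunE (negbTE ne) expr0.
Qed.

Lemma weight_neq0 lam d : (forall i, lam i != 0) -> weight lam d != 0.
Proof. by move=> l0; apply/prodf_neq0 => i _; rewrite expf_neq0. Qed.

Lemma multihomog_scale d f lam x : multihomog d f -> f (scale lam x) = weight lam d * f x.
Proof.
elim=> {d f}.
- by move=> c; rewrite weight0 mul1r.
- by move=> d _ [i [j [-> ->]]]; rewrite mxE weight_unit.
- by move=> d; rewrite mulr0.
- by move=> d f g _ -> _ ->; rewrite mulrDr.
- by move=> d e f g _ -> _ ->; rewrite weightD mulrACA.
Qed.

Lemma prod_proj_pt (x y : prod_proj K m) : same_pt x y ->
  exists2 lam, (forall i, lam i != 0) & sval y = scale lam (sval x).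
Proof.
move=> xy; have [c H] : {c : 'I_k -> K & forall i, c i != 0 /\ sval y i = c i *: sval x i}.
  apply: (@choice _ _ (fun i c => c != 0 /\ sval y i = c *: sval x i)) => i.
  by have [c c0 E] := xy i; exists c.
exists c; first by move=> i; case: (H i).
by apply: functional_extensionality_dep => i; case: (H i).
Qed.

Lemma graded_prod_proj : graded (prod_proj K m).
Proof.
split.
- exact: gen_const.
- by move=> *; exact: gen_mul.
- move=> x y /prod_proj_pt[lam lam0 E]; exists (weight lam); split.
    by move=> d; exact: weight_neq0.
  by move=> d f /homog_multihomog[F hF ->]; rewrite E (multihomog_scale _ _ hF).
Qed.

End Multiprojective.

Lemma graded_Proj (K : closedFieldType) (E : Type) (R : nat -> set (E -> K)) :
  R 0%N (fun=> 1) ->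
  (forall d e f g, R d f -> R e g -> R (d + e)%N (fun x => f x * g x)) ->
  graded (Proj R).
Proof.
move=> R1 RM; split.
- exists (fun=> 1) => //; apply: funext => p; by case: p.
- move=> d e _ _ [f Rf ->] [g Rg ->].
  exists (fun x => f x * g x); first exact: RM.
  by apply: funext => -[p /= p1 pL pM pN]; rewrite pM.
- move=> p q [c c0 H]; exists (fun d => c ^- d); split.
    by move=> d; rewrite invr_eq0 expf_neq0.
  by move=> d _ [f Rf ->]; rewrite H // mulKf // expf_neq0.
Qed.

Section GrassmannianGraded.
Variables (K : closedFieldType) (r n : nat).

Lemma grassmannian_scale d (f : grassmannian K r n -> K) (A B : grassmannian K r n) g :
  homog d f -> sval B = g *m sval A -> f B = \det g ^+ d * f A.
Proof.
move=> hf E; elim: hf => {d f}.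
- by move=> c; rewrite expr0 mul1r.
- by move=> d f [-> [t [_ ->]]]; rewrite E -mulmx_colsub det_mulmx expr1.
- by move=> d; rewrite mulr0.
- by move=> d f h _ -> _ ->; rewrite mulrDr.
- move=> d e f h _ -> _ ->; rewrite exprD; ring.
Qed.

Lemma row_free_mul_unitmx (V : 'M[K]_r) (A : 'M[K]_(r, n)) :
  row_free (V *m A) -> V \in unitmx.
Proof.
rewrite -row_free_unit -!kermx_eq0 => /rowV0P fVA; apply/rowV0P => v /sub_kermxP vV.
by apply: (fVA v); apply/sub_kermxP; rewrite mulmxA vV mul0mx.
Qed.

Lemma grassmannian_pt (A B : grassmannian K r n) : same_pt A B ->
  exists2 g, g \in unitmx & sval B = g *m sval A.
Proof.
move=> /andP[_ /submxP[g E]]; exists g => //; apply: (@row_free_mul_unitmx _ (sval A)).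
by rewrite -E; exact: (svalP B).
Qed.

Lemma graded_grassmannian : graded (grassmannian K r n).
Proof.
split.
- exact: gen_const.
- by move=> *; exact: gen_mul.
- move=> A B /grassmannian_pt[g gu E]; exists (fun d => \det g ^+ d); split.
    by move=> d; rewrite expf_neq0 // -unitfE -unitmxE.
  by move=> d f hf; exact: grassmannian_scale.
Qed.

End GrassmannianGraded.

(** * The Segre-Veronese embedding *)

Section SegreVeronese.
Variables (K : closedFieldType) (k : nat) (m c : 'I_k -> nat).
Hypothesis c_gt0 : forall i, (0 < c i)%N.

(** A monomial with [c i] ordered factors from the [i]-th group of variables, the [q]-th of them
    having index [J i q]. Total functions on [nat] make single slots easy to change; [slots_eq] is
    equality of the slots that count. *)
Definition labels := 'I_k -> nat -> nat.

Definition sv (J : labels) (x : affine_space K m) : K :=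
  \prod_i \prod_(q < c i) x i 0 (inord (J i q)).

Definition upd (J : labels) i q v : labels :=
  fun i' q' => if (i' == i) && (q' == q) then v else J i' q'.

Definition slots_eq (J J' : labels) : Prop :=
  forall i q, (q < c i)%N -> inord (J i q) = inord (J' i q) :> 'I_(m i).+1.

(** Equations of the Segre-Veronese variety. The exchanges of one slot are quadratic and
    characterize decomposable tensors; the transpositions with slot 0 generate the symmetry among
    the slots of one group. *)
Record segre_rel (y : labels -> K) : Prop := SegreRel {
  segre_ext : forall J J', slots_eq J J' -> y J = y J';
  segre_exch : forall J J' i q, (q < c i)%N ->
    y J * y J' = y (upd J i q (J' i q)) * y (upd J' i q (J i q));
  segre_sym : forall J i q, (q < c i)%N ->
    y (upd (upd J i 0 (J i q)) i q (J i 0%N)) = y J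
}.

Lemma upd_id (J : labels) i q : upd J i q (J i q) = J.
Proof.
apply: funext => i'; apply: funext => q'; rewrite /upd.
by case: andP => // -[/eqP -> /eqP ->].
Qed.

Lemma upd_upd (J : labels) i q v v' : upd (upd J i q v) i q v' = upd J i q v'.
Proof. by apply: funext => i'; apply: funext => q'; rewrite /upd; case: andP. Qed.

Lemma upd_same (J : labels) i q v : upd J i q v i q = v.
Proof. by rewrite /upd !eqxx. Qed.

Lemma sv_upd (J : labels) x i q : (q < c i)%N ->
  exists rest, forall v, sv (upd J i q v) x = rest * x i 0 (inord v).
Proof.
move=> qi; pose q0 := Ordinal qi.
exists ((\prod_(i' | i' != i) \prod_(q < c i') x i' 0 (inord (J i' q))) *
  \prod_(q' < c i | q' != q0) x i 0 (inord (J i q'))) => v.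
rewrite /sv (bigD1 i) //= (bigD1 q0) //= upd_same mulrC mulrA mulrAC; congr (_ * _ * _).
- apply: eq_bigr => i' ne; apply: eq_bigr => q' _.
  by rewrite /upd (negbTE ne).
- by apply: eq_bigr => q' ne; rewrite /upd eqxx [_ == q](negbTE ne).
Qed.

Lemma sv_ext J J' x : slots_eq J J' -> sv J x = sv J' x.
Proof. by move=> H; apply: eq_bigr => i _; apply: eq_bigr => q _; rewrite H. Qed.

Lemma sv_rel x : segre_rel (sv^~ x).
Proof.
split=> [J J'|J J' i q qi|J i q qi]; first exact: sv_ext.
  have [a Ea] := sv_upd J x qi; have [b Eb] := sv_upd J' x qi.
  rewrite -{1}(upd_id J i q) -{1}(upd_id J' i q) !Ea !Eb; ring.
pose s := tperm (Ordinal (c_gt0 i)) (Ordinal qi).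
rewrite /sv [LHS](bigD1 i) //= [RHS](bigD1 i) //=; congr (_ * _).
  rewrite [RHS](reindex_inj (@perm_inj _ s)) /=; apply: eq_bigr => q' _.
  congr (x i 0 (inord _)); rewrite /upd eqxx /s /=.
  case: tpermP => [->|->|/eqP n1 /eqP n2] /=; rewrite ?eqxx //.
    by case: eqVneq => // <-.
  by rewrite [_ == q](negbTE n2) [_ == 0%N](negbTE n1).
apply: eq_bigr => i' ne; apply: eq_bigr => q' _.
by rewrite /upd (negbTE ne).
Qed.

Lemma slots_degree : [ffun i => c i] = \sum_i \sum_(q < c i) unit_degree i.
Proof.
apply/ffunP => i; rewrite ffunE sum_ffunE (bigD1 i) //= [X in _ + X]big1 => [|i' ne].
  rewrite [RHS]addr0 sum_ffunE (eq_bigr (fun=> 1%N)) ?sum1_card ?card_ord // => q _.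
  by rewrite ffunE eqxx.
by rewrite sum_ffunE big1 // => q _; rewrite ffunE eq_sym (negbTE ne).
Qed.

Lemma sv_multihomog J : multihomog [ffun i => c i] (sv J).
Proof.
rewrite slots_degree.
apply: generated_prod => i _; apply: generated_prod => q _.
by apply: gen_base; exists i, (inord (J i q)).
Qed.

Lemma sv_neq0 (x : affine_space K m) : (forall i, x i != 0) -> exists J, sv J x != 0.
Proof.
move=> x0; have [J HJ] : {J : 'I_k -> nat & forall i, x i 0 (inord (J i)) != 0}.
  apply: (@choice _ _ (fun i j => x i 0 (inord j) != 0)) => i.
  by have /rV0Pn[j Hj] := x0 i; exists j; rewrite inord_val.
exists (fun i _ => J i); apply/prodf_neq0 => i _; apply/prodf_neq0 => q _; exact: HJ.
Qed.

(* With [b i q v = y (upd J0 i q v) / y J0], the exchange relations give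
   [y J / y J0 = prod_(i, q) b i q (J i q)], and the symmetry makes the vectors
   [b i q] and [b i 0] proportional. *)
Lemma sv_surj y J0 : segre_rel y -> y J0 != 0 ->
  exists2 x : affine_space K m, (forall i, x i != 0) &
    exists2 a : K, a != 0 & forall J, y J = a * sv J x.
Proof.
move=> [ext exch sym] y0.
pose b i q v := y (upd J0 i q v) / y J0.
have bE i q v : (q < c i)%N -> b i q v = b i q (J0 i 0%N) * b i 0%N v.
  move=> qi; rewrite /b.
  have [->|q0] := eqVneq q 0%N; first by rewrite upd_id divff ?mul1r.
  pose J1 := upd (upd J0 i 0 v) i q (J0 i 0%N).
  have E1 : y J1 = y (upd J0 i q v).
    have := sym (upd J0 i q v) i q qi; rewrite upd_same => <-; congr y.
    apply: funext => i'; apply: funext => q'; rewrite /J1 /upd.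
    case: (eqVneq i' i) => //= ->; rewrite eqxx /= [0%N == q]eq_sym (negbTE q0).
    by case: (eqVneq q' q) => //= ->; rewrite (negbTE q0).
  have := exch J1 J0 i 0%N (c_gt0 i); rewrite E1.
  have -> : J1 i 0%N = v.
    by rewrite /J1 /upd [0%N == q]eq_sym (negbTE q0) !andbF !eqxx.
  have -> : upd J1 i 0 (J0 i 0%N) = upd J0 i q (J0 i 0%N).
    apply: funext => i'; apply: funext => q'; rewrite /J1 /upd.
    case: (eqVneq i' i) => //= ->; case: (eqVneq q' 0%N) => //= ->.
    by rewrite eq_sym (negbTE q0).
  by move=> E; rewrite mulrACA -E mulrACA divff // mulr1.
have bJ0 i q : b i q (J0 i q) = 1 by rewrite /b upd_id divff.
have b0 i q : (q < c i)%N -> b i q (J0 i 0%N) != 0.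
  move=> qi; have := bE i q (J0 i q) qi; rewrite bJ0 => E.
  by apply/eqP => b0; move: E; rewrite b0 mul0r => /eqP; rewrite oner_eq0.
have b_inord i q v : (q < c i)%N -> b i q (inord v : 'I_(m i).+1) = b i q v.
  move=> qi; congr (_ / _); apply: ext => i' q' _; rewrite /upd.
  by case: andP => // -[/eqP -> _]; rewrite inord_val.
(* [hyb s J] agrees with [J] on the slots in [s] and with [J0] elsewhere; one exchange relation per
   slot yields the product formula. *)
pose hyb (s : seq ('I_k * nat)) (J : labels) : labels :=
  fun i q => if (i, q) \in s then J i q else J0 i q.
have hybE J s : uniq s -> all (fun p => p.2 < c p.1)%N s ->
    y (hyb s J) / y J0 = \prod_(p <- s) b p.1 p.2 (J p.1 p.2).
  elim: s => [|[i q] s IH] /=; first by rewrite big_nil divff.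
  move=> /andP[nin us] /andP[qi als]; rewrite big_cons -IH //= /b mulrACA.
  have -> : hyb ((i, q) :: s) J = upd (hyb s J) i q (J i q).
    apply: funext => i'; apply: funext => q'.
    rewrite /hyb /upd in_cons xpair_eqE; case: andP => //= -[/eqP -> /eqP ->] //.
  have := exch (upd (hyb s J) i q (J i q)) J0 i q qi.
  rewrite upd_same upd_upd.
  have <- : hyb s J i q = J0 i q by rewrite /hyb (negbTE nin).
  by rewrite upd_id => E; rewrite [y (upd J0 _ _ _) * _]mulrC -E mulrACA divff // mulr1.
exists (fun i => \row_v b i 0%N v).
  move=> i; apply/rV0Pn; exists (inord (J0 i 0%N)).
  by rewrite mxE b_inord // bJ0 oner_eq0.
exists (y J0 * \prod_i \prod_(q < c i) b i q (J0 i 0%N)).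
  rewrite mulf_neq0 //; apply/prodf_neq0 => i _; apply/prodf_neq0 => q _.
  exact: b0.
move=> J; rewrite -mulrA /sv -big_split /=.
under eq_bigr => i _ do rewrite -big_split /=.
pose s := [seq (i, nat_of_ord q) | i <- enum 'I_k, q <- enum 'I_(c i)].
have us : uniq s.
  apply: allpairs_uniq_dep; first exact: enum_uniq.
    by move=> i _; exact: enum_uniq.
  move=> [i q] [i' q'] _ _ /= [ei]; case: _ / ei q' => q' /val_inj -> //.
have als : all (fun p => p.2 < c p.1)%N s.
  by apply/allP => _ /allpairsPdep[i [q [_ _ ->]]] /=.
have -> : y J = y (hyb s J).
  apply: ext => i q qi; rewrite /hyb; case: ifP => // /negP[].
  by apply/allpairsPdep; exists i, (Ordinal qi); rewrite !mem_enum.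
rewrite -[LHS](mulfVK y0) hybE // mulrC; congr (_ * _).
rewrite big_allpairs_dep /= [LHS]big_enum /=; apply: eq_bigr => i _.
rewrite [LHS]big_enum /=; apply: eq_bigr => q _.
by rewrite bE // mxE b_inord.
Qed.

End SegreVeronese.

(** A projective space needs finitely many coordinates. Truncating slots and values at the maxima
    [C] and [M] leaves finitely many labels, up to [slots_eq]. *)
Lemma labels_code (k : nat) (m c : 'I_k -> nat) :
  exists N (dec : 'I_N.+1 -> labels k) (enc : labels k -> 'I_N.+1),
    forall J, slots_eq m c (dec (enc J)) J.
Proof.
pose M := (\max_i m i)%N; pose C := (\max_i c i)%N.
pose F := {ffun 'I_k * 'I_C.+1 -> 'I_M.+1}.
have F0 : (0 < #|F|)%N by apply/card_gt0P; exists [ffun=> ord0].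
exists #|F|.-1, (fun j i q => nth [ffun=> ord0] (enum F) j (i, inord q)),
  (fun J => inord (index [ffun p : 'I_k * 'I_C.+1 =>
     inord (inord (J p.1 p.2) : 'I_(m p.1).+1) : 'I_M.+1] (enum F))).
move=> J i q qi /=.
set f : F := (X in index X _).
rewrite inordK; last by rewrite prednK // cardE index_mem mem_enum.
rewrite nth_index ?mem_enum // ffunE /= inordK; last first.
  by apply: leq_trans (ltn_ord _) _; rewrite ltnS; exact: leq_bigmax.
rewrite inord_val inordK //; apply: leq_trans qi _; apply: leq_trans (leqnSn _).
exact: leq_bigmax.
Qed.

Section Veronese.
Variables (K : closedFieldType) (k : nat) (m c : 'I_k -> nat).
Hypothesis c_gt0 : forall i, (0 < c i)%N.
Variables (N : nat) (dec : 'I_N.+1 -> labels k) (enc : labels k -> 'I_N.+1).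
Hypothesis decK : forall J, slots_eq m c (dec (enc J)) J.

Let P := prod_proj K m.
Let PN := proj_space K N.

Definition veronese_vec (x : affine_space K m) : affine_space K (fun _ : 'I_1 => N) :=
  fun _ => \row_j sv c (dec j) x.

Lemma veronese_vecE x J : veronese_vec x 0 0 (enc J) = sv c J x.
Proof. by rewrite mxE; exact: sv_ext. Qed.

Lemma veronese_vec_neq0 (x : affine_space K m) : (forall i, x i != 0) ->
  forall i, veronese_vec x i != 0.
Proof.
move=> x0 i; have [J HJ] := sv_neq0 c x0; apply/rV0Pn; exists (enc J).
by rewrite (ord1 i) veronese_vecE.
Qed.

Definition veronese (x : P) : PN := exist _ _ (veronese_vec_neq0 (svalP x)).

Lemma veronese_homog e (h : PN -> K) : homog e h ->
  homog [ffun i => (e ord0 * c i)%N] (h \o veronese).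
Proof.
move=> /homog_multihomog[H hH ->]; apply: multihomog_homog (H \o veronese_vec) _.
move: e H hH; apply: generated_sub.
- by apply/ffunP => i; rewrite !ffunE mul0n.
- by move=> d e; apply/ffunP => i; rewrite !ffunE mulnDl.
- move=> d _ [i [j [-> ->]]].
  have -> : [ffun i0 => (unit_degree i ord0 * c i0)%N] = [ffun i => c i].
    by apply/ffunP => i'; rewrite !ffunE (ord1 i) eqxx mul1n.
  have -> : (fun x : affine_space K (fun=> N) => x i 0 j) \o veronese_vec = sv c (dec j).
    by apply: funext => x /=; rewrite mxE.
  exact: sv_multihomog.
Qed.

Lemma same_pt_proj (z z' : PN) (a : K) : a != 0 ->
  (forall j, sval z' 0 0 j = a * sval z 0 0 j) -> same_pt z z'.
Proof.
by move=> a0 E; rewrite /same_pt /= => i; exists a => //; apply/rowP => j; rewrite (ord1 i) mxE E.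
Qed.

Lemma proj_same_pt (z z' : PN) : same_pt z z' ->
  exists2 a : K, a != 0 & forall j, sval z' 0 0 j = a * sval z 0 0 j.
Proof. by move=> /(_ 0)[a a0 E]; exists a => // j; rewrite E mxE. Qed.

Lemma veronese_pt (x x' : P) : same_pt x x' -> same_pt (veronese x) (veronese x').
Proof.
move=> /(homog_pt (graded_prod_proj K m))[chi [chi0 H]].
apply: (@same_pt_proj _ _ (chi [ffun i => c i])) => // j; rewrite !mxE.
by apply: (H _ (fun x : P => sv c (dec j) (sval x))); apply: multihomog_homog; exact: sv_multihomog.
Qed.

Lemma veronese_morphism : is_morphism veronese.
Proof.
apply: morphism_local.
- exact: graded_prod_proj.
- exact: veronese_pt.
- move=> x0; exists setT, (fun e : {ffun 'I_1 -> nat} => [ffun i => (e ord0 * c i)%N]), (fun _ _ => 1); split=> //.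
  + exact: (zopenT (graded_prod_proj K m)).
  + by move=> *; exact: oner_neq0.
  + move=> e h /veronese_homog hh; exists (h \o veronese); split.
      apply: twist_homog => //; first exact: graded_prod_proj.
      exact: (zopenT (graded_prod_proj K m)).
    by move=> x _; rewrite mul1r.
Qed.

(** Varying slot 0 of group [i] in [J0] and fixing the other slots turns [sv] into a nonzero
    multiple of the vector [x i], so the monomials determine each [x i] up to a scalar. *)
Lemma sv_scale (x x' : affine_space K m) J0 a : a != 0 -> sv c J0 x != 0 ->
  (forall J, sv c J x' = a * sv c J x) ->
  exists lam : 'I_k -> K, (forall i, lam i != 0) /\ x' = scale lam x.
Proof.
move=> a0 s0 E.
have [lam H] : {lam : 'I_k -> K & forall i, lam i != 0 /\ x' i = lam i *: x i}.
  apply: (@choice _ _ (fun i l => l != 0 /\ x' i = l *: x i)) => i.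
  have [b Eb] := sv_upd J0 x (c_gt0 i); have [b' Eb'] := sv_upd J0 x' (c_gt0 i).
  have b0 : b != 0.
    apply: contraNneq s0 => b0; have := Eb (J0 i 0%N).
    by rewrite upd_id b0 mul0r => ->.
  have b'0 : b' != 0.
    apply: contraNneq (mulf_neq0 a0 s0) => b'0; have := Eb' (J0 i 0%N).
    by rewrite upd_id b'0 mul0r E => ->.
  exists (a * b / b'); split; first by rewrite !mulf_neq0 // invr_eq0.
  apply/rowP => v; have := E (upd J0 i 0 v); rewrite Eb Eb' inord_val mxE => Ev.
  by apply: (mulfI b'0); rewrite Ev; field.
exists lam; split; first by move=> i; case: (H i).
by apply: functional_extensionality_dep => i; case: (H i).
Qed.

Lemma veronese_inj (x x' : P) : same_pt (veronese x) (veronese x') -> same_pt x x'.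
Proof.
move=> /proj_same_pt[a a0 E]; have [J0 HJ0] := sv_neq0 c (svalP x).
have [|lam [lam0 El]] := sv_scale a0 HJ0 (x' := sval x').
  by move=> J; have := E (enc J); rewrite !veronese_vecE.
by rewrite /same_pt /= => i; exists (lam i) => //; rewrite El.
Qed.

Definition veronese_image : set PN := [set z | exists x, same_pt z (veronese x)].

(** The second hypothesis is there because [enc (dec j)] may differ from [j]: several indices can
    code the same monomial. *)
Lemma veronese_imageP (z : PN) :
  segre_rel m c (fun J => sval z 0 0 (enc J)) ->
  (forall j, sval z 0 0 j = sval z 0 0 (enc (dec j))) -> veronese_image z.
Proof.
move=> rel zE; have /rV0Pn[j zj] := svalP z 0; rewrite zE in zj.
have [x x0 [a a0 E]] := sv_surj c_gt0 rel zj.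
exists (exist _ x x0); apply: (@same_pt_proj _ _ a^-1); first by rewrite invr_eq0.
by move=> j'; rewrite mxE zE E mulKf.
Qed.

Let coordN (j : 'I_N.+1) (z : PN) := sval z 0 0 j.

Lemma coordN_homog j : homog (unit_degree ord0) (coordN j).
Proof. by apply: gen_base; exists ord0, j. Qed.

(** By contraposition: a point at which all homogeneous functions vanishing on the image vanish
    satisfies the Segre relations, hence lies on the image. *)
Lemma veronese_closed : zopen (~` veronese_image).
Proof.
move=> z nz.
suff [d [h [hh hz h0]]] : exists d (h : PN -> K),
    [/\ homog d h, h z != 0 & forall x, h (veronese x) = 0].
  exists d, h; split=> // y /= hy [x yx]; move/eqP: hy; apply.
  have [chi [chi0 H]] := homog_pt (graded_prod_proj _ _) yx.
  by apply: (mulfI (chi0 d)); rewrite -H // h0 mulr0.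
apply: contrapT => nh.
have vanish d (h : PN -> K) : homog d h -> (forall x, h (veronese x) = 0) -> h z = 0.
  move=> hh h0; apply/eqP; apply: contrapT => /negP hz; apply: nh.
  by exists d, h.
have vanish1 j j' : (forall x : P, sv c (dec j) (sval x) = sv c (dec j') (sval x)) ->
    coordN j z = coordN j' z.
  move=> E; apply/eqP; rewrite -subr_eq0; apply/eqP.
  have := vanish (unit_degree ord0) (fun z => coordN j z + -1 * coordN j' z).
  rewrite mulN1r; apply.
    apply: gen_add; first exact: coordN_homog.
    rewrite -[unit_degree _]add0r; apply: gen_mul; first exact: gen_const.
    exact: coordN_homog.
  by move=> x; rewrite /coordN !mxE E mulN1r subrr.
apply: nz; apply: veronese_imageP; last first.
  by move=> j; apply: vanish1 => x; apply: sv_ext => i q qi; rewrite decK.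
split=> [J J' JJ'|J J' i q qi|J i q qi].
- by apply: vanish1 => x; apply: sv_ext => i q qi; rewrite !decK // JJ'.
- apply/eqP; rewrite -subr_eq0; apply/eqP.
  set J1 := upd J _ _ _; set J2 := upd J' _ _ _.
  have := vanish (unit_degree ord0 + unit_degree ord0) (fun z =>
    coordN (enc J) z * coordN (enc J') z + -1 * (coordN (enc J1) z * coordN (enc J2) z)).
  rewrite mulN1r; apply.
    apply: gen_add; first by apply: gen_mul; exact: coordN_homog.
    rewrite -[unit_degree _ + unit_degree _]add0r; apply: gen_mul; first exact: gen_const.
    by apply: gen_mul; exact: coordN_homog.
  move=> x; rewrite /coordN !veronese_vecE mulN1r.
  by rewrite (segre_exch (sv_rel c_gt0 _) _ _ qi) subrr.
- apply: vanish1 => x; rewrite !(sv_ext _ (decK _)).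
  exact: (segre_sym (sv_rel c_gt0 _)).
Qed.

Definition veronese_inv (z : subvariety veronese_image) : P := projT1 (cid (svalP z)).

Lemma veronese_invP (z : subvariety veronese_image) :
  same_pt (sval z) (veronese (veronese_inv z)).
Proof. exact: (projT2 (cid (svalP z))). Qed.

Lemma proj_same_pt_sym (z z' : PN) : same_pt z z' -> same_pt z' z.
Proof.
move=> /proj_same_pt[a a0 E]; apply: (@same_pt_proj _ _ a^-1); first by rewrite invr_eq0.
by move=> j; rewrite E mulKf.
Qed.

Lemma proj_same_pt_trans (z z' z'' : PN) : same_pt z z' -> same_pt z' z'' -> same_pt z z''.
Proof.
move=> /proj_same_pt[a a0 E] /proj_same_pt[b b0 E'].
apply: (@same_pt_proj _ _ (b * a)); first by rewrite mulf_neq0.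
by move=> j; rewrite E' E mulrA.
Qed.

Lemma veronese_inv_uniq (z : subvariety veronese_image) x :
  same_pt (sval z) (veronese x) -> same_pt (veronese_inv z) x.
Proof.
move=> zx; apply: veronese_inj; apply: proj_same_pt_trans zx.
exact/proj_same_pt_sym/veronese_invP.
Qed.

Lemma veronese_inv_morphism : is_morphism veronese_inv.
Proof.
have gS := graded_sub veronese_image (graded_prod_proj K (fun _ : 'I_1 => N)).
apply: morphism_local => //.
  move=> z z' zz'; apply: veronese_inv_uniq; apply: proj_same_pt_trans zz' _.
  exact: veronese_invP.
move=> z0; have [a1 a10 E0] := proj_same_pt (veronese_invP z0).
have [J0 HJ0] := sv_neq0 c (svalP (veronese_inv z0)).
rewrite -veronese_vecE E0 mulf_eq0 negb_or in HJ0; case/andP: HJ0 => _ HJ0.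
(* On the chart [W] where the coordinate of [J0] does not vanish, the inverse is the linear map [G]:
   its [i]-th vector reads the coordinates whose labels differ from [J0] at most in slot 0 of group
   [i]. [lam] compares it with the representative chosen by [veronese_inv]. *)
pose G (z : affine_space K (fun _ : 'I_1 => N)) : affine_space K m :=
  fun i => \row_v z 0 0 (enc (upd J0 i 0 v)).
pose W : set (subvariety veronese_image) := [set z | coordN (enc J0) (sval z) != 0].
have [lam Hlam] : {lam : subvariety veronese_image -> 'I_k -> K & forall z, W z ->
    (forall i, lam z i != 0) /\ G (sval (sval z)) = scale (lam z) (sval (veronese_inv z))}.
  apply: (@choice _ _ (fun z l => W z -> (forall i, l i != 0) /\
    G (sval (sval z)) = scale l (sval (veronese_inv z)))) => z.
  have [Wz|nWz] := EM (W z); last by exists (fun=> 0) => /nWz.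
  suff [l H] : {l : 'I_k -> K & forall i, l i != 0 /\
      G (sval (sval z)) i = l i *: sval (veronese_inv z) i}.
    exists l => _; split; first by move=> i; case: (H i).
    by apply: functional_extensionality_dep => i; case: (H i).
  apply: (@choice _ _ (fun i b => b != 0 /\
      G (sval (sval z)) i = b *: sval (veronese_inv z) i)) => i.
  have [a a0 E] := proj_same_pt (proj_same_pt_sym (veronese_invP z)).
  have [b Eb] := sv_upd J0 (sval (veronese_inv z)) (c_gt0 i).
  exists (a * b); split.
    apply/eqP => ab0; move: Wz; rewrite /W /= /coordN E.
    by rewrite veronese_vecE -(upd_id J0 i 0) Eb mulrA ab0 mul0r eqxx.
  by apply/rowP => v; rewrite !mxE E veronese_vecE Eb inord_val mulrA.
exists W, (fun e : {ffun 'I_k -> nat} => [ffun _ : 'I_1 => (\sum_i e i)%N]),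
  (fun z e => (weight (lam z) e)^-1); split.
- apply: zopen_homog; exists (coordN (enc J0)) => //; exact: coordN_homog.
- exact: HJ0.
- by move=> z e Wz; rewrite invr_eq0; apply: weight_neq0; case: (Hlam z Wz).
- move=> e h /homog_multihomog[H hH ->]; exists (fun z => H (G (sval (sval z)))); split.
    apply: twist_homog => //.
      by apply: zopen_homog; exists (coordN (enc J0)) => //; exact: coordN_homog.
    exists (fun z => H (G (sval z))) => //; apply: (multihomog_homog (f := H \o G)).
    move: e H hH; apply: generated_sub.
    + by apply/ffunP => i; rewrite !ffunE big1 // => i' _; rewrite ffunE.
    + move=> d e; apply/ffunP => i; rewrite !ffunE -big_split.
      by apply: eq_bigr => i' _; rewrite ffunE.
    + move=> d _ [i [j [-> ->]]].
      apply: gen_base; exists ord0, (enc (upd J0 i 0 j)); split.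
        apply/ffunP => i'; rewrite !ffunE (ord1 i') eqxx (bigD1 i) //= ffunE eqxx.
        by rewrite big1 // => j' ne; rewrite ffunE (negbTE ne).
      by apply: funext => z /=; rewrite mxE.
  move=> z Wz; have [l0 ->] := Hlam z Wz.
  by rewrite (multihomog_scale _ _ hH) mulKf // weight_neq0.
Qed.

End Veronese.

Theorem multidegree_very_ample (K : closedFieldType) (k : nat) (m c : 'I_k -> nat) :
  (forall i, 0 < c i)%N ->
  very_ample (twist [ffun i => c i] : line_bundle (prod_proj K m)).
Proof.
move=> c0; have [N [dec [enc decK]]] := labels_code m c.
exists N, (fun j (x : prod_proj K m) => sv c (dec j) (sval x)), (veronese decK); split.
- move=> j; apply: twist_homog.
  + exact: graded_prod_proj.
  + exact/zopenT/graded_prod_proj.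
  + by apply: multihomog_homog; exact: sv_multihomog.
- by [].
- exact: veronese_morphism.
- exact: veronese_closed.
- exists (@veronese_inv _ _ _ _ _ _ _ decK); split; first exact: veronese_inv_morphism.
  by move=> z x; exact: veronese_inv_uniq.
Qed.

(** * Numerical data of the Richardson variety *)

Section Numerics.
Variables (r n : nat).
Hypotheses (r_gt0 : (0 < r)%N) (rn : (r < n)%N).

Let a := a_ r n.

Lemma a_bounds i : (n * i <= r * a i < n * i + r)%N.
Proof.
rewrite /a /a_ /ceil_div; have := divn_eq (n * i + r.-1) r.
have := ltn_pmod (n * i + r.-1) r_gt0.
move: (_ %/ r)%N (_ %% r)%N => q t; rewrite [(r * q)%N]mulnC; lia.
Qed.

Lemma a_0 : a 0 = 0%N.
Proof. by have := a_bounds 0; nia. Qed.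

Lemma a_r : a r = n.
Proof. by have := a_bounds r; nia. Qed.

Lemma a_ltS i : (a i < a i.+1)%N.
Proof. by have := a_bounds i; have := a_bounds i.+1; nia. Qed.

Lemma a_mono i j : (i <= j)%N -> (a i <= a j)%N.
Proof.
elim: j => [|j IH]; first by case: i.
by rewrite leq_eqVlt => /orP[/eqP -> //|/IH]; have := a_ltS j; lia.
Qed.

Lemma a_lt i j : (i < j)%N -> (a i < a j)%N.
Proof. by move=> ij; apply: leq_trans (a_ltS i) (a_mono ij). Qed.

Lemma a_leP i j : (a i <= a j)%N = (i <= j)%N.
Proof. by apply/idP/idP => [|/a_mono //]; apply: contraLR; rewrite -!ltnNge; exact: a_lt. Qed.

Lemma c_mul i : (c_ r n i + n * i = r * a i)%N.
Proof. by have := a_bounds i; rewrite /c_ -/(a i); lia. Qed.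

Lemma c_lt i : (c_ r n i < r)%N.
Proof. by have := a_bounds i; have := c_mul i; lia. Qed.

(** Otherwise [r] divides [n * i], hence [i]. All uses of coprimality go through this positivity. *)
Lemma c_gt0 i : coprime r n -> (0 < i < r)%N -> (0 < c_ r n i)%N.
Proof.
move=> cop /andP[i0 ir]; rewrite lt0n; apply/eqP => c0; have := c_mul i; rewrite c0 add0n => E.
have : (r %| n * i)%N by rewrite E dvdn_mulr.
by rewrite Gauss_dvdr // gtnNdvd.
Qed.

Lemma block_exists j : (j < n)%N -> exists2 i, (i < r)%N & (a i <= j < a i.+1)%N.
Proof.
move=> jn; have ex : exists i, (j < a i)%N by exists r; rewrite a_r.
case: (ex_minnP ex) => -[|i] ji min; first by rewrite a_0 in ji.
exists i; first by rewrite -ltnS; apply: min; rewrite a_r.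
by rewrite ji andbT leqNgt; apply/negP => /min; rewrite ltnn.
Qed.

Lemma block_uniq i i' j : (a i <= j < a i.+1)%N -> (a i' <= j < a i'.+1)%N -> i = i'.
Proof.
move=> /andP[h1 h2] /andP[h3 h4]; apply/eqP; rewrite eqn_leq; apply/andP; split.
  by rewrite -ltnS ltnNge -a_leP -ltnNge; lia.
by rewrite -ltnS ltnNge -a_leP -ltnNge; lia.
Qed.

Variable l : nat -> nat.
Hypothesis lb : forall i, (0 < i < r)%N -> (a i.-1 + 2 <= l i <= a i)%N.

Lemma block_le i j i' : (a i <= j < a i.+1)%N -> (i < r)%N -> (a i' <= j)%N = (i' <= i)%N.
Proof.
move=> /andP[h1 h2] ir; apply/idP/idP => [h|/a_mono]; last lia.
by rewrite -ltnS ltnNge -a_leP -ltnNge; lia.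
Qed.

(* The columns where row [i] (counted from 0) of a staircase matrix may be nonzero. *)
Definition window i j := (v_ l i.+1 <= j.+1)%N && (j < a i.+1)%N.

Lemma window_block i j : (i < r)%N -> (a i <= j < a i.+1)%N -> window i j.
Proof.
rewrite /window /v_; case: i => [|i] ir /=; first by case/andP.
by move=> /andP[h ->]; have := @lb i.+1; rewrite ir /=; lia.
Qed.

(** Since [l i.+1] is at least [a i + 2], column [a i], counted from 0, lies before the window of
    row [i.+1]. So the first column of each block belongs to one row only, which makes the rows of a
    staircase matrix independent. *)
Lemma window_start i i' : (i < r)%N -> (i' < r)%N -> window i' (a i) = (i' == i).
Proof.
move=> ir i'r; case: (ltngtP i' i) => [lt|gt|->].
- apply/negbTE; rewrite /window; case: i' lt i'r => [|i'] lt i'r /=.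
    by rewrite -leqNgt a_mono.
  by rewrite negb_and -[in X in _ || X]leqNgt a_mono // orbT.
- apply/negbTE; rewrite /window; case: i' gt i'r => // i' gt i'r; rewrite /v_ /=.
  by have := @lb i'.+1; rewrite i'r /=; have := @a_mono i i'; lia.
- by apply: window_block => //; rewrite leqnn a_ltS.
Qed.

End Numerics.

(** * Staircase matrices *)

Section CoordinateProjections.
Variables (K : fieldType) (n : nat).
Implicit Types P Q : pred 'I_n.

(** The Schubert conditions, the opposite ones and the numerical criterion all become bounds on
    ranks of [A *m dmx P]. *)
Definition dmx P : 'M[K]_n := diag_mx (\row_j (P j)%:R).

Lemma mul_dmxE r (A : 'M[K]_(r, n)) P i j : (A *m dmx P) i j = if P j then A i j else 0.
Proof. by rewrite mul_mx_diag !mxE; case: (P j); rewrite ?mulr1 ?mulr0. Qed.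

Lemma mul_dmx_dmx r (A : 'M[K]_(r, n)) P Q :
  A *m dmx P *m dmx Q = A *m dmx (fun j => P j && Q j).
Proof. by apply/matrixP => i j; rewrite !mul_dmxE; case: (P j); case: (Q j). Qed.

Lemma dmx_sub P Q r (A : 'M[K]_(r, n)) : (forall j, Q j -> P j) ->
  A *m dmx P = 0 -> A *m dmx Q = 0.
Proof.
move=> PQ A0; apply/matrixP => i j; rewrite mul_dmxE mxE; case: ifP => // /PQ Pj.
by move/matrixP: A0 => /(_ i j); rewrite mul_dmxE Pj mxE.
Qed.

Lemma rank_dmx_sub P Q r (A : 'M[K]_(r, n)) : (forall j, Q j -> P j) ->
  (\rank (A *m dmx Q) <= \rank (A *m dmx P))%N.
Proof.
move=> PQ; have -> : A *m dmx Q = A *m dmx P *m dmx Q.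
  by rewrite mul_dmx_dmx; congr (_ *m _); congr diag_mx; apply/rowP => j;
     rewrite !mxE; case Qj: (Q j); rewrite ?andbF // PQ.
exact: mxrankM_maxl.
Qed.

Lemma kermx_dmx P : (kermx (dmx (predC P)) :=: dmx P)%MS.
Proof.
apply/eqmxP/andP; split; last first.
  rewrite sub_kermx; apply/eqP/matrixP => i j; rewrite mul_dmxE !mxE /=.
  by case: (eqVneq i j) => [->|_]; rewrite ?mulr0n ?if_same //; case: (P j).
apply/rV_subP => v /sub_kermxP v0.
suff -> : v = v *m dmx P by exact: submxMl.
apply/rowP => j; rewrite mul_dmxE; case: ifPn => // nPj.
by move/rowP: v0 => /(_ j); rewrite mul_dmxE /= nPj mxE.
Qed.

Lemma rank_cap_dmx r (A : 'M[K]_(r, n)) P t : row_free A ->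
  (t <= \rank (A :&: dmx P)%MS)%N = (\rank (A *m dmx (predC P)) + t <= r)%N.
Proof.
move=> /eqP rA; have := mxrank_mul_ker A (dmx (predC P)); rewrite rA.
rewrite (cap_eqmx (eqmx_refl A) (kermx_dmx P)).
move: (\rank _) (\rank _) => x y; lia.
Qed.

Lemma mul_pid_mxE r q (M : 'M[K]_(r, q)) t i j :
  (pid_mx t *m M : 'M_(r, q)) i j = if (i < t)%N then M i j else 0.
Proof.
rewrite mxE (bigD1 i) //= big1 => [|i' ne].
  by rewrite !mxE eqxx addr0 /=; case: ltnP; rewrite ?mul1r ?mul0r.
by rewrite -val_eqE eq_sym /= in ne; rewrite !mxE (negbTE ne) mul0r.
Qed.

Lemma rank_top0 r q (M : 'M[K]_(r, q)) t : (t <= r)%N ->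
  (forall (i : 'I_r) j, (i < t)%N -> M i j = 0) -> (\rank M + t <= r)%N.
Proof.
move=> tr H; have -> : M = copid_mx t *m M.
  rewrite mulmxBl mul1mx -[LHS]subr0; congr (_ - _); apply/matrixP => i j.
  by rewrite mul_pid_mxE mxE; case: ifP => // /H.
rewrite addnC -leq_subRL //; apply: leq_trans (mxrankM_maxl _ _) _.
by rewrite rank_copid_mx.
Qed.

Lemma rank_bot0 r q (M : 'M[K]_(r, q)) t : (t <= r)%N ->
  (forall (i : 'I_r) j, (t <= i)%N -> M i j = 0) -> (\rank M <= t)%N.
Proof.
move=> tr H; have -> : M = (pid_mx t : 'M_r) *m M.
  by apply/matrixP => i j; rewrite mul_pid_mxE; case: ltnP => // /H.
by apply: leq_trans (mxrankM_maxl _ _) _; rewrite rank_pid_mx.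
Qed.

End CoordinateProjections.

Lemma flag_dmx (K : closedFieldType) n t : flag K n t = dmx K (fun j => (j < t)%N).
Proof.
apply/matrixP => i j; rewrite !mxE /=; case: (eqVneq i j) => [->|ne].
  by rewrite eqxx mulr1n.
by rewrite -val_eqE /= in ne; rewrite (negbTE ne) mulr0n.
Qed.

Lemma opp_flag_dmx (K : closedFieldType) n t :
  opp_flag K n t = dmx K (fun j => (n - t <= j)%N).
Proof.
apply/matrixP => i j; rewrite !mxE /=; case: (eqVneq i j) => [->|ne].
  by rewrite eqxx /= !mulr1n [(n - t <= j)%N]leqNgt; case: (j < n - t)%N; rewrite ?subrr ?subr0.
by rewrite -val_eqE /= in ne; rewrite (negbTE ne) /= mulr0n subr0.
Qed.

Lemma card_ord_lt n p : (p <= n)%N -> #|(fun j : 'I_n => j < p)%N| = p.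
Proof.
move=> pn; rewrite -sum1_card -(big_ord_widen n (fun=> 1%N)) //.
by rewrite sum1_card card_ord.
Qed.

Lemma card_ord_ge n p : (p <= n)%N -> #|(fun j : 'I_n => p <= j)%N| = (n - p)%N.
Proof.
move=> pn; have := cardC (fun j : 'I_n => (j < p)%N); rewrite card_ord_lt // card_ord => E.
rewrite -[in RHS]E addKn; apply: eq_card => j; rewrite !inE.
by rewrite -leqNgt.
Qed.

Section Staircase.
Variables (K : closedFieldType) (r n : nat).
Hypotheses (r_gt0 : (0 < r)%N) (rn : (r < n)%N).
Variable l : nat -> nat.
Let a := a_ r n.
Let v := v_ l.
Hypothesis lb : forall i, (0 < i < r)%N -> (a i.-1 + 2 <= l i <= a i)%N.

(** By rank-nullity, a large intersection with a coordinate subspace is a small rank after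
    projection to the complementary coordinates. The opposite conditions are reindexed by
    [t = r - i]. *)
Definition in_richardson (A : 'M[K]_(r, n)) : Prop :=
  (forall t, (0 < t <= r)%N -> (\rank (A *m dmx K (fun j => a t <= j)%N) + t <= r)%N) /\
  (forall i, (i < r)%N -> (\rank (A *m dmx K (fun j => j.+1 < v i.+1)%N) <= i)%N).

Lemma v_bounds i : (i < r)%N -> (1 <= v i.+1 <= n)%N.
Proof.
move=> ir; rewrite /v /v_; case: i ir => [|i] ir /=; first by rewrite (ltn_trans r_gt0).
have := lb (i := i.+1); rewrite ir /= => /(_ isT).
have := a_mono r_gt0 rn (ltnW ir); rewrite a_r // -/a; lia.
Qed.

Lemma v_mono i i' : (i <= i')%N -> (i' < r)%N -> (v i.+1 <= v i'.+1)%N.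
Proof.
rewrite leq_eqVlt => /orP[/eqP -> //|ii'] i'r.
have := v_bounds i'r; case: i ii' => [|i] ii' /=; first by case/andP.
case: i' ii' i'r => // i' ii' i'r _; rewrite /v /v_ /=.
have := lb (i := i.+1); have := lb (i := i'.+1); have := a_mono r_gt0 rn (ii' : (i.+1 <= i')%N); rewrite -!/a /=; lia.
Qed.

Lemma richardsonE (A : grassmannian K r n) :
  richardson v a A <-> in_richardson (sval A).
Proof.
have rA := svalP A.
have oppE i : (i < r)%N ->
    (r - i <= \rank (sval A :&: opp_flag K n (n - v i.+1 + 1))%MS)%N =
    (\rank (sval A *m dmx K (fun j => (j.+1 < v i.+1)%N)) <= i)%N.
  move=> ir; rewrite opp_flag_dmx rank_cap_dmx //.
  have -> : dmx K (predC (fun j : 'I_n => (n - (n - v i.+1 + 1) <= j)%N)) =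
            dmx K (fun j => (j.+1 < v i.+1)%N).
    congr diag_mx; apply/rowP => j; rewrite !mxE /=; congr (_%:R).
    by congr nat_of_bool; have := v_bounds ir; have := ltn_ord j; lia.
  by move: (\rank _) => x; lia.
have schE t : (t <= \rank (sval A :&: flag K n (a t))%MS)%N =
    (\rank (sval A *m dmx K (fun j => a t <= j)%N) + t <= r)%N.
  rewrite flag_dmx rank_cap_dmx //; congr (\rank (_ *m _) + _ <= _)%N.
  by congr diag_mx; apply/rowP => j; rewrite !mxE /= -leqNgt.
split=> -[H1 H2]; split.
- by move=> t /H2; rewrite schE.
- move=> i ir; rewrite -oppE //.
  have := H1 (r - i)%N; have -> : (r - (r - i) + 1 = i.+1)%N by lia.
  by apply; lia.
- move=> t tr; have := oppE (r - t)%N; have -> : (r - t + 1 = (r - t).+1)%N by lia.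
  have -> : (r - (r - t) = t)%N by lia.
  by move=> -> //; [apply: H2|]; lia.
- by move=> t /H1; rewrite schE.
Qed.

Definition staircase (B : 'M[K]_(r, n)) : Prop :=
  (forall (i : 'I_r) (j : 'I_n), ~~ window r n l i j -> B i j = 0) /\
  (forall (i : 'I_r) (j : 'I_n), (a i <= j < a i.+1)%N -> B i j != 0).

Lemma start_lt (i : 'I_r) : (a i < n)%N.
Proof. by have := a_lt r_gt0 rn (ltn_ord i); rewrite a_r. Qed.

Lemma staircase_free B : staircase B -> row_free B.
Proof.
move=> [B0 B1]; rewrite -kermx_eq0; apply/rowV0P => u /sub_kermxP uB.
apply/rowP => i; rewrite mxE.
move/rowP: uB => /(_ (Ordinal (start_lt i))); rewrite !mxE (bigD1 i) //= big1.
  move=> /eqP; rewrite addr0 mulf_eq0 => /orP[/eqP //|/negPn/negP[]].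
  by apply: B1; rewrite /= leqnn a_ltS.
move=> i' ne; rewrite B0 ?mulr0 //=.
by rewrite window_start.
Qed.

Lemma staircase_in B : staircase B -> in_richardson B.
Proof.
move=> [B0 _]; split.
  move=> t tr; apply: rank_top0; first by case/andP: tr.
  move=> i j it; rewrite mul_dmxE; case: ifP => // tj; apply: B0.
  rewrite negb_and -[X in _ || X]leqNgt; apply/orP; right.
  by apply: leq_trans tj; exact: a_mono.
move=> i ir; apply: rank_bot0; first exact: ltnW.
move=> i' j ii'; rewrite mul_dmxE; case: ifP => // tj; apply: B0.
rewrite negb_and -ltnNge; apply/orP; left; apply: leq_trans tj _.
exact: v_mono.
Qed.

(* The inequality [r |P| <= n rank (A (dmx P))], for all [P], is the numerical
   criterion for the semistability of the row space of [A]. *)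
Lemma staircase_exists (A : 'M[K]_(r, n)) : row_free A -> in_richardson A ->
  coprime r n ->
  (forall P : pred 'I_n, (r * #|P| <= n * \rank (A *m dmx K P))%N) ->
  exists2 V : 'M_r, V \in unitmx & staircase (V *m A) /\
    forall i : 'I_r, (0 < i)%N -> exists j : 'I_n, (j < a i)%N && ((V *m A) i j != 0).
Proof.
move=> fA [XA1 XA2] cop ss.
have rA : \rank A = r by apply/eqP.
(* The columns outside the window of row [i] have rank at most [(r - i.+1) + i < r], by one
   condition on each side; a nontrivial relation among the rows restricted to them is the vector
   [u i]. *)
have /choice[u Hu] : forall i : 'I_r, exists u : 'rV[K]_r, u != 0 /\
    forall j : 'I_n, ~~ window r n l i j -> (u *m A) 0 j = 0.
  move=> i.
  pose Q1 := fun j : 'I_n => (a i.+1 <= j)%N; pose Q2 := fun j : 'I_n => (j.+1 < v i.+1)%N.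
  pose M := A *m dmx K (fun j => Q1 j || Q2 j).
  have rM : (\rank M < r)%N.
    have -> : M = A *m dmx K (fun j => Q1 j && ~~ Q2 j) + A *m dmx K Q2.
      apply/matrixP => i' j; rewrite [RHS]mxE !mul_dmxE.
      by case: (Q1 j); case: (Q2 j); rewrite ?addr0 ?add0r.
    apply: leq_ltn_trans (mxrank_add _ _) _.
    have h1 := XA1 i.+1 (ltn_ord i); have h2 := XA2 i (ltn_ord i).
    have h3 : (\rank (A *m dmx K (fun j => Q1 j && ~~ Q2 j)) <= \rank (A *m dmx K Q1))%N.
      by apply: rank_dmx_sub => j /andP[].
    rewrite -/Q1 in h1; rewrite -/Q2 in h2.
    move: (\rank _) (\rank _) (\rank _) h1 h2 h3 => x y z; lia.
  have : kermx M != 0.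
    by rewrite kermx_eq0 /row_free neq_ltn rM.
  move=> /rowV0Pn[u /sub_kermxP uM u0]; exists u; split=> // j nw.
  move/rowP: uM => /(_ j); rewrite /M mulmxA mul_dmxE [RHS]mxE.
  suff -> : Q1 j || Q2 j by [].
  by move: nw; rewrite negb_and -ltnNge -leqNgt orbC.
pose V : 'M_r := \matrix_i u i.
have VA i j : (V *m A) i j = (u i *m A) 0 j.
  by rewrite -[in RHS](rowK u i) -row_mul [RHS]mxE.
have B0 (i : 'I_r) (j : 'I_n) : ~~ window r n l i j -> (V *m A) i j = 0.
  by move=> nw; rewrite VA; apply (Hu i).2.
(* If entry [j] of the block vanished, [u i] would kill the columns [I1], of rank at least [r - i]
   by semistability. The Richardson condition bounds the rank of the larger set [I2] by [r - i], so
   both have the same row relations and [u i] kills [I2], then also [I3]. *)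
have B1 (i : 'I_r) (j : 'I_n) : (a i <= j < a i.+1)%N -> (V *m A) i j != 0.
  move=> ij; apply/eqP => VAij0; have ir := ltn_ord i; have ab := a_bounds r_gt0 rn.
  have an t : (t <= r)%N -> (a t <= n)%N.
    by move=> tr; rewrite -[X in (_ <= X)%N](a_r r_gt0 rn) a_mono.
  pose I1 := fun j' : 'I_n => (a i.+1 <= j')%N || (j' == j).
  pose I2 := fun j' : 'I_n => (a i <= j')%N.
  pose I0 := fun j' : 'I_n => (j'.+1 < v i.+1)%N.
  have uI1 : u i *m (A *m dmx K I1) = 0.
    apply/rowP => j'; rewrite mulmxA mul_dmxE [RHS]mxE; case: ifP => // /orP[h|/eqP ->].
      by apply (Hu i).2; rewrite negb_and -[X in _ || X]leqNgt h orbT.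
    by rewrite -VA.
  have rI1 : (r - i <= \rank (A *m dmx K I1))%N.
    have := ss I1.
    have -> : #|I1| = (n - a i.+1 + 1)%N.
      rewrite -(card_ord_ge (an i.+1 ir)) -[in RHS](card1 j) -[RHS]cardUI.
      rewrite [X in (_ + X)%N]eq_card0 ?addn0 // => j'; rewrite !inE.
      by case: eqP => [->|]; rewrite ?andbF // andbT; apply/negbTE; case/andP: ij; rewrite -ltnNge.
    have := ab i.+1; have := an i.+1 ir; rewrite -/a.
    move: (\rank _) => x; nia.
  have rI2 : (\rank (A *m dmx K I2) <= r - i)%N.
    have [i0|i0] := posnP i; first by rewrite i0 subn0 rank_leq_row.
    by have := XA1 i; rewrite i0 (ltnW ir) => /(_ isT); rewrite addnC -leq_subRL // ltnW.
  have uI2 : u i *m (A *m dmx K I2) = 0.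
    apply/sub_kermxP; have -> : (kermx (A *m dmx K I2) :=: kermx (A *m dmx K I1))%MS.
      apply/eqmxP; have le : (kermx (A *m dmx K I2) <= kermx (A *m dmx K I1))%MS.
        apply/sub_kermxP; rewrite mulmxA.
        apply: (@dmx_sub _ _ I2); last by rewrite -mulmxA mulmx_ker.
        by move=> j' /orP[|/eqP ->]; rewrite /I2; have := a_ltS r_gt0 rn i; rewrite -/a; lia.
      rewrite -(mxrank_leqif_eq le) eqn_leq mxrankS //= !mxrank_ker.
      by move: (\rank _) (\rank _) rI1 rI2 => x y; lia.
    exact/sub_kermxP.
  pose I3 := fun j' : 'I_n => I0 j' || I2 j'.
  have uI3 : u i *m (A *m dmx K I3) = 0.
    apply/rowP => j'; rewrite mulmxA mul_dmxE [RHS]mxE; case: ifP => // /orP[h|h].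
      by apply (Hu i).2; rewrite negb_and -ltnNge; apply/orP; left.
    by move/rowP: uI2 => /(_ j'); rewrite mulmxA mul_dmxE h [RHS]mxE.
  (* For [i > 0] the columns left out of [I3] run from [l i] to [a i], counted from 1; there are at
     most [a i - a i.-1 - 1] of them. Semistability then forces full rank, so that [u i] would be
     zero. *)
  have rI3 : row_free (A *m dmx K I3).
    rewrite /row_free eqn_leq rank_leq_row /=; have := ss I3.
    have v1 : (v i.+1 - 1 <= a i)%N.
      rewrite /v /v_; case: (nat_of_ord i) ir => [|i'] ir //=.
      by have := lb (i := i'.+1); rewrite ir /= => /(_ isT); lia.
    have -> : #|I3| = (v i.+1 - 1 + (n - a i))%N.
      rewrite -(card_ord_ge (an i (ltnW ir))) -(@card_ord_lt n (v i.+1 - 1)); last first.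
        by apply: leq_trans v1 _; exact: an (ltnW ir).
      rewrite -[RHS]cardUI [X in (_ + X)%N]eq_card0 ?addn0; last first.
        by move=> j'; rewrite !inE; apply/negbTE; lia.
      by apply: eq_card => j'; rewrite !inE /I3 /I0 /I2 unfold_in; congr orb; lia.
    have := ab i; have := an i (ltnW ir); rewrite -/a.
    move: v1; rewrite /v /v_; case: (nat_of_ord i) ir => [|i'] ir /= v1.
      by have := a_0 r_gt0 rn; rewrite -/a => -> _ _; move: (\rank _) => x; nia.
    have := lb (i := i'.+1); rewrite ir /= => /(_ isT); have := ab i'; rewrite -/a.
    move: (\rank _) => x; nia.
  case: (Hu i) => /negP[]; apply/eqP; move: rI3; rewrite -kermx_eq0 => /rowV0P; apply.
  exact/sub_kermxP.
have sB : staircase (V *m A) by split.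
have Vu := row_free_mul_unitmx (staircase_free sB).
exists V => //; split=> // i i0; apply: contrapT => nj.
have ir := ltn_ord i.
(* Without a shared entry, row [i] and the later rows vanish on the first [a i] columns.
   Semistability then gives [r * a i <= n * i], contrary to [c i > 0]. *)
have rk : (\rank (A *m dmx K (fun j => j < a i)%N) <= i)%N.
  rewrite -(eqmxMfull _ (A := V)); last by rewrite row_full_unit.
  apply: rank_bot0; first exact: ltnW.
  move=> i' j ii'; rewrite mulmxA mul_dmxE; case: ifP => // ja.
  move: ii'; rewrite leq_eqVlt => /orP[/eqP /val_inj <-|ii'].
    by apply/eqP; apply: contrapT => /negP h; apply: nj; exists j; rewrite ja.
  apply: B0; rewrite negb_and -ltnNge; apply/orP; left.
  case: i' ii' => [[|i'] i'r] //= ii'; rewrite /v_ /=.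
  have := lb (i := i'.+1); rewrite i'r /= => /(_ isT).
  by have := a_mono r_gt0 rn (ii' : (i <= i')%N); rewrite -/a; lia.
have := ss (fun j => j < a i)%N; rewrite card_ord_lt; last first.
  by have := a_mono r_gt0 rn (ltnW ir); rewrite a_r.
have := c_gt0 r_gt0 rn (i := i) cop; rewrite i0 ir => /(_ isT).
have := c_mul r_gt0 rn i; rewrite -/a.
by move: rk; move: (\rank _) => x; nia.
Qed.

End Staircase.

(** * The numerical criterion *)

(** If [p] and [q] differ, the polynomial ['X * (p - q) + 1] is not constant; at a root [t] of it,
    [t] is nonzero and [p] and [q] take different values. *)
Lemma poly_eq_nonzero (K : closedFieldType) (p q : {poly K}) :
  (forall t, t != 0 -> p.[t] = q.[t]) -> p = q.
Proof.
move=> H; apply/eqP; rewrite -subr_eq0; apply: contrapT => /negP f0.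
have /closed_rootP[t] : size ('X * (p - q) + 1) != 1%N.
  have sz : size ('X * (p - q)) = (size (p - q)).+1 by rewrite mulrC size_mulX.
  by rewrite size_polyDl sz ?eqSS ?size_poly_eq0 // size_poly1 ltnS lt0n size_poly_eq0.
rewrite /root !hornerE.
have [->|t0] := eqVneq t 0; first by rewrite mul0r add0r oner_eq0.
by rewrite H // subrr mulr0 add0r oner_eq0.
Qed.

Lemma homog_curve (K : closedFieldType) r n d (F : grassmannian K r n -> K)
    (y : K -> grassmannian K r n) : homog d F ->
  (forall i j, exists p : {poly K}, forall t, sval (y t) i j = p.[t]) ->
  exists p : {poly K}, forall t, F (y t) = p.[t].
Proof.
move=> hF /= Y.
have /choice[p Hp] : forall ij : 'I_r * 'I_n, exists p : {poly K},
  forall t, sval (y t) ij.1 ij.2 = p.[t] by move=> [i j]; exact: Y.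
elim: hF => {d F}.
- by move=> c; exists c%:P => t; rewrite hornerC.
- move=> d F [_ [tau [_ ->]]].
  exists (\det (\matrix_(i, j) p (i, tau j))) => t.
  rewrite -[RHS]/(horner_eval t _) -det_map_mx; congr (\det _); apply/matrixP => i j.
  by rewrite !mxE (Hp (i, tau j)).
- by move=> d; exists 0 => t; rewrite horner0.
- by move=> d f g _ [p1 H1] _ [p2 H2]; exists (p1 + p2) => t; rewrite hornerD H1 H2.
- by move=> d e f g _ [p1 H1] _ [p2 H2]; exists (p1 * p2) => t; rewrite hornerM H1 H2.
Qed.

Section NumericalCriterion.
Variables (K : closedFieldType) (r n : nat).
Hypotheses (r_gt0 : (0 < r)%N) (rn : (r < n)%N).
Variable l : nat -> nat.
Let a := a_ r n.
Let v := v_ l.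
Hypothesis lb : forall i, (0 < i < r)%N -> (a i.-1 + 2 <= l i <= a i)%N.

Let X : set (grassmannian K r n) := richardson v a.

(** Membership is a family of upper bounds on ranks, so it passes to torus translates and to limits
    of one-parameter subgroups. *)
Lemma in_richardson_le (A B : 'M[K]_(r, n)) :
  (forall P, \rank (B *m dmx K P) <= \rank (A *m dmx K P))%N ->
  in_richardson l A -> in_richardson l B.
Proof.
move=> H [H1 H2]; split=> [t /H1|i /H2]; apply: leq_trans => //.
by rewrite leq_add2r.
Qed.

Definition richardson_pt (A : 'M[K]_(r, n)) (fA : row_free A) (XA : in_richardson l A) :
  subvariety X := exist _ (exist _ A fA) ((richardsonE r_gt0 rn lb (exist _ A fA)).2 XA).

Lemma in_richardson_val (x : subvariety X) : in_richardson l (sval (sval x)).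
Proof. exact/(richardsonE r_gt0 rn lb)/(svalP x). Qed.

Lemma richardson_twist_scale d (s : subvariety X -> K) (x y : subvariety X) g :
  twist d setT s -> g \in unitmx -> sval (sval y) = g *m sval (sval x) ->
  s y = \det g ^+ d * s x.
Proof.
move=> ts gu E.
apply: (@twist_scale _ _ _ d setT s (fun d => \det g ^+ d)) => //.
- by move=> e; rewrite expf_neq0 // -unitfE -unitmxE.
- by move=> e f; rewrite exprD.
- by move=> e _ [F hF ->] /=; exact: grassmannian_scale.
Qed.

Lemma mul_diag_free (A : 'M[K]_(r, n)) (d : 'rV[K]_n) : (forall j, d 0 j != 0) ->
  row_free A -> row_free (A *m diag_mx d).
Proof.
move=> d0; rewrite /row_free mxrankMfree //.
rewrite row_free_unit unitmxE det_diag unitfE; exact/prodf_neq0.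
Qed.

Lemma mul_diag_in (A : 'M[K]_(r, n)) (d : 'rV[K]_n) :
  in_richardson l A -> in_richardson l (A *m diag_mx d).
Proof.
apply: in_richardson_le => P.
by rewrite -mulmxA diag_mxC mulmxA mxrankM_maxl.
Qed.

Lemma torus_neq0 (d : 'rV[K]_n) : torus d -> forall j, d 0 j != 0.
Proof.
move=> dT j; apply/eqP => dj; have := oner_neq0 K; rewrite -dT.
by rewrite (bigD1 j) //= dj mul0r eqxx.
Qed.

Lemma inv_section_orbit d (s : subvariety X -> K) (x y : subvariety X) g (t : 'rV[K]_n) :
  inv_sections d s -> torus t -> g \in unitmx ->
  sval (sval x) *m diag_mx t = g *m sval (sval y) ->
  s x = \det g ^+ (n * d) * s y.
Proof.
move=> [ts sT] tT gu E.
pose xt := richardson_pt (mul_diag_free (torus_neq0 tT) (svalP (sval x))) (mul_diag_in t (in_richardson_val x)).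
by rewrite -(sT t x xt) // (richardson_twist_scale ts gu (y := xt) (x := y)).
Qed.

(* The one-parameter subgroup with weights [-#|predC P|] on [P] and
   [n - #|predC P|] off [P], applied to [A] and renormalized by row operations,
   has a limit in the Richardson variety; if [n * rank (A (dmx P)) < r #|P|]
   then an invariant section along this curve carries a positive power of the
   parameter [t]. *)
Lemma semistable_rank (x : subvariety X) : semistable x ->
  forall P : pred 'I_n, (r * #|P| <= n * \rank (sval (sval x) *m dmx K P))%N.
Proof.
move=> [d [s [d0 sd sx]]] P; rewrite leqNgt; apply/negP => lt.
set A := sval (sval x) in lt *.
have fA : row_free A := svalP (sval x).
(* Row operations from the rank factorization of the [P]-columns give [C], whose rows of index at
   least [rho] vanish on [P]. *)
pose M := A *m dmx K P; pose rho := \rank M; pose g := invmx (col_ebase M).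
pose C := g *m A.
have gu : g \in unitmx by rewrite unitmx_inv col_ebase_unit.
have CP : C *m dmx K P = pid_mx rho *m row_ebase M.
  by rewrite /C -mulmxA -/M -{1}(mulmx_ebase M) -!mulmxA mulKmx ?col_ebase_unit.
have rC Q : (\rank (C *m dmx K Q) <= \rank (A *m dmx K Q))%N.
  by rewrite /C -mulmxA mxrankM_maxr.
have fC : row_free C by rewrite /row_free (eqmxMfull _ _) // row_full_unit.
have AE : A = invmx g *m C by rewrite mulKmx.
move: C CP rC fC AE => C CP rC fC AE.
have C0 (i : 'I_r) (j : 'I_n) : (rho <= i)%N -> P j -> C i j = 0.
  move=> ri Pj; have := mul_dmxE C P i j; rewrite Pj => <-.
  by rewrite CP mxE big1 // => k _; rewrite mxE ltnNge ri andbF mul0r.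
pose q := #|[predC P]|.
have PqE : (#|P| + q = n)%N by rewrite cardC card_ord.
have n0 : (0 < n)%N by apply: leq_ltn_trans rn.
have rhor : (rho <= r)%N by exact: rank_leq_row.
(* [At t] is [C *m diag_mx (Lam t)] with the factor [t ^+ n] removed from the rows of index at least
   [rho]. It is polynomial in [t], and its value at 0 is the limit. *)
pose At (t : K) : 'M[K]_(r, n) :=
  \matrix_(i, j) (if (i < rho)%N && ~~ P j then t ^+ n * C i j else C i j).
pose Lam (t : K) : 'rV[K]_n := \row_j (if P j then 1 else t ^+ n).
pose S (t : K) : 'M[K]_r := diag_mx (\row_i (if (i < rho)%N then 1 else t ^+ n)).
have StAt t : S t *m At t = C *m diag_mx (Lam t).
  apply/matrixP => i j; rewrite mul_diag_mx mul_mx_diag !mxE.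
  case: (ltnP i rho) => ir /=; case: (boolP (P j)) => Pj /=; rewrite ?mul1r ?mulr1 //.
  - by rewrite mulrC.
  - by rewrite C0 // mulr0.
  - by rewrite mulrC.
have detS t : \det (S t) = t ^+ (n * (r - rho)).
  rewrite det_diag (bigID (fun i : 'I_r => (i < rho)%N)) /= big1 => [|i ir]; last by rewrite mxE ir.
  rewrite mul1r (eq_bigr (fun=> t ^+ n)) => [|i ir]; last by rewrite mxE (negbTE ir).
  rewrite prodr_const -exprM; congr (_ ^+ (_ * _)).
  by rewrite -(card_ord_ge rhor); apply: eq_card => i; rewrite /in_mem /= -leqNgt.
have prodLam t : \prod_j Lam t 0 j = t ^+ (n * q).
  rewrite (bigID P) /= big1 => [|j Pj]; last by rewrite mxE Pj.
  rewrite mul1r (eq_bigr (fun=> t ^+ n)) => [|j Pj]; last by rewrite mxE (negbTE Pj).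
  by rewrite prodr_const -exprM.
have Su t : t != 0 -> S t \in unitmx by move=> t0; rewrite unitmxE detS unitfE expf_neq0.
have Lam0 t : t != 0 -> forall j, Lam t 0 j != 0.
  by move=> t0 j; rewrite mxE; case: ifP; rewrite ?oner_neq0 ?expf_neq0.
have freeAt t : row_free (At t).
  have [->|t0] := eqVneq t 0; last first.
    have := mul_diag_free (Lam0 t t0) fC; rewrite -StAt /row_free => /eqP E.
    by rewrite eqn_leq rank_leq_row /= -{1}E mxrankM_maxr.
  rewrite -kermx_eq0; apply/rowV0P => u /sub_kermxP uA.
  have u0 (i : 'I_r) : (i < rho)%N -> u 0 i = 0.
    move=> ir; have : u *m (C *m dmx K P) = 0.
      apply/rowP => j; rewrite mulmxA mul_dmxE; case: ifP => Pj; last by rewrite mxE.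
      rewrite -uA !mxE; apply: eq_bigr => k _; rewrite mxE Pj andbF //.
    rewrite CP => /(congr1 (mulmx^~ (invmx (row_ebase M)))).
    rewrite mulmxA mulmxK ?row_ebase_unit // mul0mx => /rowP.
    have irn : (i < n)%N by apply: leq_trans ir (rank_leq_col _).
    move=> /(_ (Ordinal irn)); rewrite !mxE (bigD1 i) //= mxE eqxx ir mulr1 big1 ?addr0 //.
    move=> k ne; rewrite -val_eqE /= in ne; by rewrite mxE (negbTE ne) mulr0.
  have : u *m C = 0.
    apply/rowP => j; rewrite -uA !mxE; apply: eq_bigr => k _; rewrite mxE.
    by case: ifP => // /andP[/u0 -> _]; rewrite !mul0r.
  move=> uC; move: fC; rewrite -kermx_eq0 => /rowV0P; apply; exact/sub_kermxP.
have inAt t : in_richardson l (At t).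
  apply: in_richardson_le (in_richardson_val x) => Q; apply: leq_trans (rC Q).
  have [->|t0] := eqVneq t 0; last first.
    rewrite -(eqmxMfull _ (A := S t)) ?row_full_unit ?Su // mulmxA StAt.
    by rewrite -mulmxA diag_mxC mulmxA mxrankM_maxl.
  (* The limit keeps the [P]-part of the first [rho] rows, and the remaining rows, which vanish on
     [P]. The rank of its [Q]-columns is at most the rank of the [P]-part of [C *m dmx K Q] plus the
     dimension of the kernel of this projection, in total the rank of [C *m dmx K Q]. *)
  have -> : At 0 = (pid_mx rho : 'M_r) *m (C *m dmx K P) + copid_mx rho *m C.
    apply/matrixP => i j; rewrite [RHS]mxE mulmxBl mul1mx [in X in _ + X]mxE [X in _ + (_ + X)]mxE.
    rewrite !mul_pid_mxE mul_dmxE mxE expr0n gtn_eqF //=.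
    case: (ltnP i rho) => ir /=; first by rewrite subrr addr0; case: (P j); rewrite ?mul0r.
    by rewrite subr0 add0r.
  rewrite mulmxDl; apply: leq_trans (mxrank_add _ _) _.
  rewrite -(mxrank_mul_ker (C *m dmx K Q) (dmx K P)); apply: leq_add.
    rewrite -!mulmxA; apply: leq_trans (mxrankM_maxr _ _) _.
    by rewrite /dmx diag_mxC.
  apply: mxrankS; rewrite sub_capmx -mulmxA submxMl /=.
  apply/sub_kermxP/matrixP => i j; rewrite mulmxA !mul_dmxE [RHS]mxE.
  case: ifP => // Pj; case: ifP => // _; rewrite mulmxBl mul1mx.
  rewrite [LHS]mxE [X in _ + X]mxE mul_pid_mxE.
  by case: (ltnP i rho) => ir; rewrite ?subrr // subr0 C0.
pose y t := richardson_pt (freeAt t) (inAt t).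
(* [Lam t] has product [t ^+ (n * q)], so the scalar [t ^- q] brings it into the torus; on [r] rows
   this scalar costs the exponent [q * r], against [n * (r - rho)] from [S t]. The difference [e]
   equals [r * #|P| - n * rho], positive by assumption. *)
pose e := (n * (r - rho) - q * r)%N.
rewrite -/M -/rho in lt.
have arith p q' h : (p + q' = n)%N -> (h <= r)%N -> (n * h < r * p)%N ->
    (n * (r - h) = n * (r - h) - q' * r + q' * r)%N /\ (0 < n * (r - h) - q' * r)%N.
  by move=> E hr; have [k ->] : exists k, r = (h + k)%N; [exists (r - h)%N|rewrite addKn -E]; nia.
have [eE e0] : (n * (r - rho) = e + q * r)%N /\ (0 < e)%N := arith _ _ _ PqE rhor lt.
have sxE t : t != 0 -> s x * \det g ^+ (n * d) = t ^+ (e * (n * d)) * s (y t).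
  move=> t0; have detg : \det g != 0 by rewrite -unitfE -unitmxE.
  pose tau := (t ^- q) *: Lam t.
  have tauT : torus tau.
    rewrite /torus /= (eq_bigr (fun j => t ^- q * Lam t 0 j)) => [|j _]; last by rewrite mxE.
    rewrite big_split /= prodr_const card_ord prodLam -exprVn -exprM mulnC exprVn mulVf //.
    by rewrite expf_neq0.
  have := @inv_section_orbit d s x (y t) (t ^- q *: (invmx g *m S t)) tau sd tauT.
  have hu : t ^- q *: (invmx g *m S t) \in unitmx.
    by rewrite unitmxZ ?unitfE ?invr_eq0 ?expf_neq0 // unitmx_mul unitmx_inv gu Su.
  move=> /(_ hu) -> /=; last first.
    rewrite -/A -scalemxAl -mulmxA StAt mulmxA -AE.
    by apply/matrixP => i j; rewrite !mul_mx_diag !mxE mulrCA.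
  rewrite detZ det_mulmx det_inv detS eE mulrAC -exprMn [in RHS]exprM.
  congr (_ ^+ _ * _); rewrite exprD exprM exprVn.
  by field; rewrite detg !expf_neq0.
have [V [oV Vy _ [b [F [G [[F' hF' FE] [G' hG' GE] FG]]]]]] := sd.1 (y 0) I.
have [b' [H [[H' hH' HE] Hy HV]]] := oV _ Vy.
have curve i j : exists p : {poly K}, forall t, sval (sval (y t)) i j = p.[t].
  have [ij|ij] := boolP ((i < rho)%N && ~~ P j).
    by exists ('X^n * (C i j)%:P) => t; rewrite mxE ij !hornerE.
  by exists (C i j)%:P => t; rewrite mxE (negbTE ij) hornerC.
have [pF pFE] := homog_curve hF' curve; have [pG pGE] := homog_curve hG' curve.
have [pH pHE] := homog_curve hH' curve.
(* [F / G] represents [s] where [H] is nonzero. Multiplying by [pH] gives an identity for all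
   nonzero [t], hence of polynomials. At 0 the right side vanishes while [G] and [H] do not, so
   [s x] would be 0. *)
pose lhs := (s x * \det g ^+ (n * d))%:P * pG * pH.
have lhsE : lhs = 'X^(e * (n * d)) * pF * pH.
  apply: poly_eq_nonzero => t t0; rewrite !hornerM hornerC hornerXn (sxE t t0).
  rewrite -pFE -pGE -pHE; have [->|Ht] := eqVneq (H' (sval (y t))) 0; first by rewrite !mulr0.
  have [Gt ->] : G (y t) != 0 /\ s (y t) = F (y t) / G (y t) by apply/FG/HV; rewrite /= HE.
  by rewrite FE GE /= in Gt *; field.
have := congr1 (fun p => p.[0]) lhsE; rewrite !hornerM hornerC hornerXn expr0n.
have -> : (e * (n * d) == 0)%N = false.
  by apply/negbTE; rewrite !muln_eq0 !negb_or -!lt0n e0 n0.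
move/eqP; rewrite !mul0r !mulf_eq0 (negbTE sx) expf_eq0 -pGE -pHE.
have [Gy _] := FG _ Vy; rewrite GE /= in Gy; rewrite (negbTE Gy).
rewrite HE /= in Hy; rewrite (negbTE Hy) !orbF /=.
by rewrite (negbTE (_ : \det g != 0)) ?andbF // -unitfE -unitmxE.
Qed.

End NumericalCriterion.

(** * The slice *)

Lemma nth_root (K : closedFieldType) n (b : K) : (0 < n)%N -> exists x, x ^+ n = b.
Proof.
move=> n0; have [x] := solve_monicpoly (fun i => if i == 0%N then b else 0) n0.
case: n n0 => // n _; rewrite big_ord_recl /= expr0 mulr1 big1 ?addr0 => [<-|i _].
  by exists x.
by rewrite mul0r.
Qed.

Lemma slice_weight_arith n r d x y c : (x <= n)%N -> (y <= r)%N ->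
  (c + n * y = r * x)%N -> ((r - y) * (n * d) = (n - x) * (r * d) + d * c)%N.
Proof.
move=> /subnKC <- /subnKC <-; rewrite !addKn; move: (n - x)%N (r - y)%N => q p E.
have /(congr1 (muln d)) : (p * x = c + q * y)%N by nia.
nia.
Qed.

Section Slice.
Variables (K : closedFieldType) (r n : nat).
Hypotheses (r_gt0 : (0 < r)%N) (rn : (r < n)%N).
Variable l : nat -> nat.
Let a := a_ r n.
Let v := v_ l.
Hypothesis lb : forall i, (0 < i < r)%N -> (a i.-1 + 2 <= l i <= a i)%N.

Let X : set (grassmannian K r n) := richardson v a.

Definition slice_dim (i : 'I_(r - 1)) : nat := (a i.+1 - l i.+1)%N.
Definition slice_deg (i : 'I_(r - 1)) : nat := c_ r n i.+1.
Let VV := affine_space K slice_dim.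

Definition coef (z : VV) (i q : nat) : K :=
  if insub i is Some i' then z i' 0 (inord q) else 0.

Lemma slice_coefE (z : VV) (i : 'I_(r - 1)) q : coef z i q = z i 0 (inord q).
Proof. by rewrite /coef valK. Qed.

(** The free entries are those of row [i] in the block of row [i.-1]. The window of row 0 is its
    block, so the value [0.-1 = 0] never selects a coordinate. *)
Definition slice_mx (z : VV) : 'M[K]_(r, n) :=
  \matrix_(i, j) if (a i <= j < a i.+1)%N then 1
                 else if window r n l i j then coef z i.-1 (j.+1 - l i) else 0.

Lemma slice_mx_staircase z : staircase l (slice_mx z).
Proof.
split=> i j; rewrite mxE; last by move=> ->; exact: oner_neq0.
move=> nw; rewrite (negbTE nw); case: ifP => // h.
by rewrite (window_block r_gt0 rn lb) in nw.
Qed.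

Definition slice (z : VV) : subvariety X :=
  richardson_pt r_gt0 rn lb (staircase_free r_gt0 rn lb (slice_mx_staircase z))
    (staircase_in r_gt0 rn lb (slice_mx_staircase z)).

Lemma window_off_block i j : (i < r)%N -> window r n l i j -> (a i <= j < a i.+1)%N = false ->
  [/\ (0 < i)%N, (l i <= j.+1)%N, (j < a i)%N & (a i.-1 <= j < a i.-1.+1)%N].
Proof.
rewrite /window /v_; case: i => [|i] ir /=.
  by have -> : a 0 = 0%N := a_0 r_gt0 rn; move=> ->.
move=> /andP[lj ja]; rewrite ja andbT => /negbT; rewrite -ltnNge => jai.
by have := lb (i := i.+1); rewrite ir /= => /(_ isT) h; split=> //; lia.
Qed.

Lemma slice_mxE z (i : 'I_r) (j : 'I_n) (i' : 'I_(r - 1)) : i = i'.+1 :> nat ->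
  window r n l i j -> (a i <= j < a i.+1)%N = false ->
  slice_mx z i j = z i' 0 (inord (j.+1 - l i)).
Proof. by move=> ii' w nb; rewrite mxE nb w ii' /= slice_coefE. Qed.

(** Multiplying the rows [i > i0] and dividing the columns [j >= a i0.+1] by [lam] fixes all entries
    of a slice matrix except the shared entries of row [i0.+1], which are multiplied by [lam]. The
    root [rho] normalizes the column scaling into the torus. With [i = i0.+1] the exponent is
    [n * (r - i) - r * (n - a i) = c i], up to the factor [d]. *)
Lemma slice_scale d (s : subvariety X -> K) (i0 : 'I_(r - 1)) (lam : K) (z : VV) :
  inv_sections d s -> lam != 0 ->
  s (slice (scale (fun i => if i == i0 then lam else 1) z)) =
  lam ^+ (d * slice_deg i0) * s (slice z).
Proof.
move=> sd lam0; have n0 : (0 < n)%N by exact: leq_ltn_trans rn.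
have i0r : (i0.+1 < r)%N by have := ltn_ord i0; lia.
have an : (a i0.+1 <= n)%N by have := a_mono r_gt0 rn (ltnW i0r); rewrite a_r.
have [rho rhoE] := nth_root (lam ^- (n - a i0.+1)) n0.
have rho0 : rho != 0.
  apply/eqP => rho0; move/eqP: rhoE.
  by rewrite rho0 expr0n gtn_eqF // eq_sym invr_eq0 expf_eq0 (negbTE lam0) andbF.
pose t : 'rV[K]_n := \row_j (rho * if (a i0.+1 <= j)%N then lam else 1).
pose gv : 'rV[K]_r := \row_i (rho * if (i0 < i)%N then lam else 1).
have tT : torus t.
  rewrite /torus /= (eq_bigr (fun j : 'I_n => rho * if (a i0.+1 <= j)%N then lam else 1)) => [|j _].
    rewrite big_split /= prodr_const card_ord rhoE -big_mkcond /= prodr_const.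
    by rewrite card_ord_ge // mulVf // expf_neq0.
  by rewrite mxE.
have detg : \det (diag_mx gv) = rho ^+ r * lam ^+ (r - i0.+1).
  rewrite det_diag (eq_bigr (fun j : 'I_r => rho * if (i0 < j)%N then lam else 1)) => [|j _].
    rewrite big_split /= prodr_const card_ord -big_mkcond /= prodr_const.
    by rewrite (card_ord_ge (ltnW i0r)).
  by rewrite mxE.
rewrite (@inv_section_orbit _ _ _ r_gt0 rn _ lb d s (slice _) (slice z) (diag_mx gv) t) //.
- congr (_ * _); rewrite detg exprMn -!exprM.
  have -> : (r * (n * d) = n * (r * d))%N by rewrite mulnCA.
  rewrite exprM rhoE -exprVn -!exprM exprVn; apply: (mulfI (_ : lam ^+ ((n - a i0.+1) * (r * d)) != 0)).
    by rewrite expf_neq0.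
  rewrite mulrA mulfV ?mul1r ?expf_neq0 // -exprD; congr (_ ^+ _).
  have := c_mul r_gt0 rn i0.+1; rewrite -/a -/(slice_deg i0).
  exact: slice_weight_arith an (ltnW i0r).
- rewrite unitmxE detg unitfE mulf_neq0 ?expf_neq0 //.
- apply/matrixP => i j; rewrite mul_mx_diag mul_diag_mx [LHS]mxE [RHS]mxE.
  have ir := ltn_ord i.
  case: (boolP (a i <= j < a i.+1)%N) => blk.
    rewrite [X in X * _]mxE blk [X in _ = _ * X]mxE blk !mxE mul1r mulr1.
    by rewrite (block_le r_gt0 rn _ blk).
  case: (boolP (window r n l i j)) => w; last first.
    by rewrite (slice_mx_staircase _).1 // mul0r (slice_mx_staircase _).1 // mulr0.
  have [ip lj ja blk'] := window_off_block ir w (negbTE blk).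
  have ir' : (i.-1 < r - 1)%N by lia.
  have ii' : i = (Ordinal ir').+1 :> nat by rewrite /= prednK.
  rewrite !(slice_mxE _ ii') ?(negbTE blk) // /scale !mxE.
  rewrite (block_le r_gt0 rn _ blk' (_ : i.-1 < r)%N); last by lia.
  have -> : (Ordinal ir' == i0) = (i.-1 == i0)%N by [].
  move: (z _ _ _) => u.
  have -> : (i0 < i)%N = (i.-1 == i0)%N || (i0 < i.-1)%N by lia.
  by case: (ltngtP i.-1 i0) => h /=; rewrite ?mul1r ?mulr1; ring.
Qed.

Lemma slice_mx_surj (E : 'M[K]_(r, n)) :
  (forall (i : 'I_r) (j : 'I_n), ~~ window r n l i j -> E i j = 0) ->
  (forall (i : 'I_r) (j : 'I_n), (a i <= j < a i.+1)%N -> E i j = 1) ->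
  exists z, slice_mx z = E.
Proof.
move=> E0 E1.
pose En (i j : nat) : K :=
  if (insub i, insub j) is (Some i', Some j') then E i' j' else 0.
have EnE (i : 'I_r) (j : 'I_n) : En i j = E i j by rewrite /En !valK.
pose z : VV := fun i => \row_q En i.+1 (q + l i.+1).-1.
exists z; apply/matrixP => i j.
case: (boolP (a i <= j < a i.+1)%N) => blk; first by rewrite E1 // mxE blk.
case: (boolP (window r n l i j)) => w; last by rewrite E0 // (slice_mx_staircase _).1.
have ir := ltn_ord i.
have [ip lj ja blk'] := window_off_block ir w (negbTE blk).
have ir' : (i.-1 < r - 1)%N by lia.
have ii' : i = (Ordinal ir').+1 :> nat by rewrite /= prednK.
rewrite (slice_mxE _ ii') ?(negbTE blk) // mxE -ii' inordK.
  by rewrite subnK // EnE.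
rewrite /slice_dim -ii'; lia.
Qed.

(** The scalar [b] depends neither on [d] nor on [s], so [x] and its slice matrix give the same
    point of the quotient. *)
Lemma semistable_slice (x : subvariety X) : coprime r n -> semistable x ->
  exists2 z : VV, (forall i, z i != 0) &
  exists2 b : K, b != 0 & forall d s, inv_sections d s -> s x = b ^+ d * s (slice z).
Proof.
move=> cop ssx; set A := sval (sval x).
have [V Vu [stair nz]] := staircase_exists r_gt0 rn lb (svalP (sval x))
  (in_richardson_val r_gt0 rn lb x) cop (semistable_rank r_gt0 rn lb ssx).
have n0 : (0 < n)%N by exact: leq_ltn_trans rn.
set B := V *m A in stair nz.
have /choice[blk blkP] : forall j : 'I_n, exists i : 'I_r, (a i <= j < a i.+1)%N.
  move=> j; have [i ir ij] := block_exists r_gt0 rn (ltn_ord j).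
  by exists (Ordinal ir).
pose beta (j : 'I_n) := B (blk j) j.
have beta0 j : beta j != 0 by apply: stair.2.
(* Dividing column [j] by [beta j] makes the block entries 1; the common factor [rho] makes the
   entries of [t] multiply to 1, and is absorbed in the row operation [g]. *)
have [rho rhoE] := nth_root (\prod_j beta j) n0.
have rho0 : rho != 0.
  apply/eqP => rho0; move/eqP: rhoE.
  rewrite rho0 expr0n gtn_eqF // eq_sym; apply/negP/prodf_neq0 => j _; exact: beta0.
pose t : 'rV[K]_n := \row_j (rho / beta j).
have tT : torus t.
  rewrite /torus /= (eq_bigr (fun j => rho / beta j)) => [|j _]; last by rewrite mxE.
  rewrite big_split /= prodr_const card_ord rhoE -big_split /= big1 // => j _.
  by rewrite mulfV.
have [z zE] : exists z, slice_mx z = rho^-1 *: (B *m diag_mx t).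
  apply: slice_mx_surj => i j h; rewrite mul_mx_diag [LHS]mxE [X in _ * X]mxE [t _ _]mxE; last first.
    have -> : B i j = beta j.
      congr (B _ _); apply: val_inj; exact: (block_uniq r_gt0 rn h (blkP j)).
    by field; rewrite rho0 beta0.
  by rewrite stair.1 // mul0r mulr0.
exists z.
  move=> i'; have i'r : (i'.+1 < r)%N by have := ltn_ord i'; lia.
  have [j /andP[ja Bj]] := nz (Ordinal i'r) isT.
  have w : window r n l i'.+1 j.
    by apply: contraNT Bj => w; apply/eqP; apply: stair.1.
  have nb : (a i'.+1 <= j < a i'.+2)%N = false by rewrite leqNgt ja.
  apply/rV0Pn; exists (inord (j.+1 - l i'.+1)).
  rewrite -(@slice_mxE z (Ordinal i'r)) // zE mul_mx_diag mxE [X in _ * X]mxE [t _ _]mxE.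
  by rewrite !mulf_neq0 ?invr_eq0 //; exact: beta0.
pose g := rho *: invmx V.
have gu : g \in unitmx by rewrite unitmxZ ?unitmx_inv // unitfE.
exists (\det g ^+ n); first by rewrite expf_neq0 // -unitfE -unitmxE.
move=> d s sd; rewrite -exprM; apply: (inv_section_orbit r_gt0 rn lb sd tT gu).
rewrite /= zE -scalemxAl -scalemxAr scalerA divff // scale1r.
by rewrite mulmxA /B mulmxA mulVmx // mul1mx.
Qed.

End Slice.

(** * Sections from tableaux *)

Lemma prod_count (R : comPzRingType) (T : eqType) (s B : seq T) (f : T -> R) :
  uniq B -> all (mem B) s -> \prod_(x <- s) f x = \prod_(j <- B) f j ^+ count_mem j s.
Proof.
move=> uB; elim: s => [|x s IH] /=.
  by move=> _; rewrite big_nil big1.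
move=> /andP[xB sB]; rewrite big_cons IH //.
under [RHS]eq_bigr do rewrite exprD.
rewrite big_split /=; congr (_ * _).
rewrite (bigD1_seq x) //= eqxx expr1 big1 ?mulr1 // => j ne.
by rewrite eq_sym (negbTE ne) expr0.
Qed.

Lemma sum_count (T : eqType) (s B : seq T) :
  uniq B -> all (mem B) s -> (\sum_(j <- B) count_mem j s = size s)%N.
Proof.
move=> uB; elim: s => [|x s IH] /=; first by move=> _; rewrite big1.
move=> /andP[xB sB]; rewrite big_split /= IH // (bigD1_seq x) //= eqxx big1 // => j ne.
by rewrite eq_sym (negbTE ne).
Qed.

Section Tableau.
Variables (r n : nat).
Hypotheses (r_gt0 : (0 < r)%N) (rn : (r < n)%N).
Variable l : nat -> nat.
Let a := a_ r n.
Let c := c_ r n.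
Hypothesis lb : forall i, (0 < i < r)%N -> (a i.-1 + 2 <= l i <= a i)%N.
Variable J : nat -> nat -> nat.
Hypothesis JP : forall i q, (0 < i < r)%N -> (q < c i)%N -> (l i <= (J i q).+1)%N /\ (J i q < a i)%N.

Definition overlap_cols (i : nat) : seq nat := [seq J i q | q <- iota 0 (c i)].

Definition block (i : nat) : seq nat := iota (a i) (a i.+1 - a i).

(* Each column of [block i] gets a total number [r] of occurrences in rows [i]
   and [i + 1] of the tableau. *)
Definition block_cols (i : nat) : seq nat :=
  flatten [seq nseq (r - count_mem j (overlap_cols i.+1)) j | j <- block i].

(** Row [i] lists the columns from which the [n] minors take their entry in row [i] of the slice
    matrix: [c i] shared entries prescribed by [J], then block entries, equal to 1. It has length
    [n] because [c i.+1 - c i = r * (a i.+1 - a i) - n]. *)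
Definition tableau_row (i : nat) : seq nat := overlap_cols i ++ block_cols i.

Definition tableau (i q : nat) : nat := nth 0%N (tableau_row i) q.

Lemma size_overlap i : size (overlap_cols i) = c i.
Proof. by rewrite size_map size_iota. Qed.

Lemma c_0 : c 0 = 0%N.
Proof. by have := c_mul r_gt0 rn 0; rewrite a_0 // -/c; lia. Qed.

Lemma c_r : c r = 0%N.
Proof. by have := c_mul r_gt0 rn r; rewrite a_r // -/c; nia. Qed.

Lemma mem_block i j : (j \in block i) = (a i <= j < a i.+1)%N.
Proof. by rewrite mem_iota subnKC // ltnW // a_ltS. Qed.

Lemma overlap_in_block i : (i < r)%N -> all (mem (block i)) (overlap_cols i.+1).
Proof.
move=> ir; apply/allP => x /mapP[q]; rewrite mem_iota /= => qc ->.
rewrite mem_block; have [i1r|i1r] := ltnP i.+1 r; last first.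
  have E : i.+1 = r by lia.
  by rewrite E c_r in qc.
have := lb (i := i.+1); rewrite i1r => /(_ isT) /= h.
by have [] := @JP i.+1 q i1r qc; lia.
Qed.

Lemma count_overlap i j : (count_mem j (overlap_cols i) <= r)%N.
Proof.
apply: leq_trans (count_size _ _) _; rewrite size_overlap ltnW //; exact: c_lt.
Qed.

Lemma size_block_cols i : (i < r)%N -> size (block_cols i) = (n - c i)%N.
Proof.
move=> ir; rewrite size_flatten /shape -map_comp sumnE big_map.
rewrite (eq_bigr (fun j => r - count_mem j (overlap_cols i.+1)))%N; last first.
  by move=> j _; rewrite /= size_nseq.
have H : (\sum_(j <- block i) (r - count_mem j (overlap_cols i.+1)) +
         \sum_(j <- block i) count_mem j (overlap_cols i.+1) = r * (a i.+1 - a i))%N.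
  rewrite -big_split /= (eq_bigr (fun=> r)) => [|j _]; last by rewrite subnK // count_overlap.
  by rewrite big_const_seq count_predT size_iota iter_addn_0.
rewrite sum_count ?iota_uniq ?overlap_in_block // size_overlap in H.
have := c_mul r_gt0 rn i; have := c_mul r_gt0 rn i.+1; rewrite -/a -/c; move: H.
have := a_ltS r_gt0 rn i; rewrite -/a; move: (\sum_(_ <- _) _)%N => S; nia.
Qed.

Lemma size_tableau_row i : (i < r)%N -> size (tableau_row i) = n.
Proof.
move=> ir; rewrite size_cat size_overlap size_block_cols // subnKC //.
by apply: leq_trans (ltnW rn); rewrite ltnW // c_lt.
Qed.

Lemma tableau_overlap i q : (q < c i)%N -> tableau i q = J i q.
Proof.
move=> qc; rewrite /tableau nth_cat size_overlap qc (nth_map 0%N) ?size_iota //.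
by rewrite nth_iota.
Qed.

Lemma tableau_block i q : (i < r)%N -> (c i <= q < n)%N -> (a i <= tableau i q < a i.+1)%N.
Proof.
move=> ir /andP[cq qn]; rewrite /tableau nth_cat size_overlap ltnNge cq /= -mem_block.
have : nth 0%N (block_cols i) (q - c i) \in block_cols i.
  by rewrite mem_nth // size_block_cols //; lia.
move=> /flatten_mapP[j jB]; by rewrite mem_nseq => /andP[_ /eqP ->].
Qed.

Lemma tableau_lt i q : (i < r)%N -> (q < n)%N -> (tableau i q < a i.+1)%N.
Proof.
move=> ir qn; have [qc|cq] := ltnP q (c i); last first.
  by have := @tableau_block i q ir; rewrite cq qn => /(_ isT) /andP[].
rewrite tableau_overlap //; case: i ir qc => [|i] ir qc; first by rewrite c_0 in qc.
by have [_ h] := @JP i.+1 q ir qc; apply: ltn_trans h (a_ltS r_gt0 rn _).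
Qed.

(** The shared columns of row [i.+1] avoid column [a i], so [block_cols i] begins with [r] copies of
    [a i]. As [c i.+1 < r], the first [c i.+1] entries of row [i] are shared columns below [a i] or
    [a i] itself, and [l i.+1] is at least [a i + 2]. *)
Lemma tableau_before_overlap i q : (i.+1 < r)%N -> (q < c i.+1)%N -> ((tableau i q).+1 < l i.+1)%N.
Proof.
move=> ir qc; have := lb (i := i.+1); rewrite ir => /(_ isT) /= lbi.
have [qc'|cq] := ltnP q (c i).
  rewrite tableau_overlap //; case: i ir qc lbi qc' => [|i] ir qc lbi qc'; first by rewrite c_0 in qc'.
  by have [_ h] := @JP i.+1 q (ltnW ir) qc'; lia.
suff -> : tableau i q = a i by lia.
rewrite /tableau nth_cat size_overlap ltnNge cq /= /block_cols /block.
have -> : (a i.+1 - a i = (a i.+1 - a i).-1.+1)%N.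
  by have := a_ltS r_gt0 rn i; rewrite -/a; lia.
rewrite /=; have -> : count_mem (a i) (overlap_cols i.+1) = 0%N.
  apply/count_memPn/negP => /mapP[q']; rewrite mem_iota /= => qc' E.
  by have [] := @JP i.+1 q' ir qc'; rewrite -E; lia.
rewrite subn0 nth_cat size_nseq.
have qr : (q - c i < r)%N by have := c_lt r_gt0 rn i.+1; rewrite -/c; lia.
by rewrite qr nth_nseq qr.
Qed.

Lemma tableau_ltS i q : (i.+1 < r)%N -> (q < n)%N -> (tableau i q < tableau i.+1 q)%N.
Proof.
move=> ir qn; have [qc|cq] := ltnP q (c i.+1).
  have := tableau_before_overlap ir qc; rewrite (tableau_overlap qc).
  by have [] := @JP i.+1 q ir qc; lia.
have := tableau_lt (ltnW ir) qn; have := @tableau_block i.+1 q ir.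
by rewrite cq qn => /(_ isT) /andP[h _] h'; exact: leq_trans h' h.
Qed.

Lemma tableau_mono i i' q : (i < i')%N -> (i' < r)%N -> (q < n)%N -> (tableau i q < tableau i' q)%N.
Proof.
elim: i' => // i' IH; rewrite ltnS leq_eqVlt => /orP[/eqP ->|ii'] ir qn; first exact: tableau_ltS.
by apply: ltn_trans (IH ii' (ltnW ir) qn) (tableau_ltS ir qn).
Qed.

(** The shared columns of row [i.+1] supply the occurrences missing from [block_cols i], so the
    products telescope over the rows. For [f] the entries of a torus element the right side is 1. *)
Lemma tableau_content (R : comPzRingType) (f : nat -> R) :
  \prod_(0 <= i < r) \prod_(0 <= q < n) f (tableau i q) = (\prod_(0 <= j < n) f j) ^+ r.
Proof.
have blockE i : (i < r)%N -> (\prod_(x <- overlap_cols i.+1) f x) * (\prod_(x <- block_cols i) f x) =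
    \prod_(a i <= j < a i.+1) f j ^+ r.
  move=> ir; rewrite (prod_count _ (iota_uniq _ _) (overlap_in_block ir)).
  rewrite /block_cols big_flatten big_map /= /block -big_split /=; apply: eq_bigr => j _.
  rewrite big_nseq iter_mulr_1 -exprD subnKC //; exact: count_overlap.
have rowE i : (i < r)%N -> \prod_(0 <= q < n) f (tableau i q) =
    (\prod_(x <- overlap_cols i) f x) * (\prod_(x <- block_cols i) f x).
  by move=> ir; rewrite -big_cat -{1}(size_tableau_row ir) -(big_nth _ xpredT f).
have allE k : (k <= r)%N -> (\prod_(0 <= i < k) \prod_(0 <= q < n) f (tableau i q)) *
    \prod_(x <- overlap_cols k) f x = \prod_(0 <= j < a k) f j ^+ r.
  elim: k => [|k IH] kr.
    by rewrite big_geq // mul1r /overlap_cols c_0 big_nil {1}/a a_0 // big_geq.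
  have recr (G : nat -> R) : \prod_(0 <= i < k.+1) G i = (\prod_(0 <= i < k) G i) * G k.
    by rewrite big_nat_recr.
  rewrite recr (rowE _ kr) mulrA (IH (ltnW kr)) -mulrA [X in _ * X]mulrC (blockE _ kr).
  by rewrite -(big_cat_nat (leq0n _) (ltnW (a_ltS r_gt0 rn k))).
have := allE r (leqnn r); rewrite /overlap_cols c_r big_nil mulr1 {1}/a a_r // => ->.
by rewrite prodrXl.
Qed.

End Tableau.

Section Sections.
Variables (K : closedFieldType) (r n : nat).
Hypotheses (r_gt0 : (0 < r)%N) (rn : (r < n)%N).
Variable l : nat -> nat.
Let a := a_ r n.
Let c := c_ r n.
Hypothesis lb : forall i, (0 < i < r)%N -> (a i.-1 + 2 <= l i <= a i)%N.

Let X : set (grassmannian K r n) := richardson (v_ l) a.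
Let m := @slice_dim r n l.
Let deg := @slice_deg r n.
Let sl (z : affine_space K m) : subvariety X := slice r_gt0 rn lb z.

(** Only the identity contributes. Let [s] be the least index moved by a contributing [pi]; then
    [pi s] and [s' = pi^-1 s] exceed [s]. The window of row [s] forces the entry of row [s.+1] in
    tableau column [q] to be shared, so the entry of row [s] lies before [l s.+1]; but the window of
    row [s'] contains it. *)
Lemma det_tableau (J : nat -> nat -> nat) (z : affine_space K m) (t : 'I_r -> 'I_n) q :
  (forall i q, (0 < i < r)%N -> (q < c i)%N -> (l i <= (J i q).+1)%N /\ (J i q < a i)%N) ->
  (q < n)%N -> (forall i : 'I_r, t i = tableau r n J i q :> nat) ->
  \det (colsub t (slice_mx z)) = \prod_i slice_mx z i (t i).
Proof.
move=> JP qn tE; rewrite /determinant (bigD1 (1%g : {perm 'I_r})) //= odd_perm1 expr0 mul1r.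
rewrite [X in X + _](eq_bigr (fun i => slice_mx z i (t i))) => [|i _]; last by rewrite mxE perm1.
rewrite [X in _ + X]big1 ?addr0 // => pi pi1; apply/eqP; rewrite mulf_eq0; apply/orP; right.
apply: contraNT pi1 => /prodf_neq0 nz.
have win (i : 'I_r) : window r n l i (tableau r n J (pi i) q).
  rewrite -tE; apply: contraNT (nz i isT) => w.
  by rewrite mxE (slice_mx_staircase r_gt0 rn lb z).1.
apply/eqP/permP => s; rewrite perm1; apply: val_inj.
have [N] := ubnP (nat_of_ord s); elim: N s => // N IH s sN.
have fixlt (s' : 'I_r) : (s' < s)%N -> pi s' = s' by move=> lt; apply: val_inj; apply: IH; lia.
case: (ltngtP (pi s) s) => // [lt|gt].
  by have := fixlt _ lt => /perm_inj E; move: lt; rewrite E ltnn.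
set s' := (pi^-1)%g s.
have ps' : pi s' = s by rewrite /s' permKV.
have ss' : (s < s')%N.
  case: (ltngtP s s') => // [lt|/val_inj E]; last by rewrite E ps' -E ltnn in gt.
  by have := fixlt _ lt; rewrite ps' => E; rewrite -E ltnn in lt.
have s1r : (s.+1 < r)%N by apply: leq_ltn_trans ss' (ltn_ord _).
have /andP[_ w1] := win s; have /andP[w2 _] := win s'.
rewrite ps' in w2.
have qc : (q < c s.+1)%N.
  rewrite ltnNge; apply/negP => cq.
  have := @tableau_block r n r_gt0 rn l lb J JP s.+1 q s1r; rewrite cq qn => /(_ isT) /andP[h _].
  have : (tableau r n J s.+1 q <= tableau r n J (pi s) q)%N.
    move: gt; rewrite leq_eqVlt => /orP[/eqP <- //|gt].
    by apply: ltnW; apply: (tableau_mono r_gt0 rn lb JP).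
  by lia.
have := tableau_before_overlap r_gt0 rn lb JP s1r qc.
have := v_mono r_gt0 rn lb ss' (ltn_ord s'); rewrite /v_ /=.
move: w2; rewrite /v_; case: (nat_of_ord s') ss' => //= s0 _; lia.
Qed.

Lemma sv_section (J : labels (r - 1)) : exists sg : subvariety X -> K,
  inv_sections 1 sg /\ forall z, sg (sl z) = sv deg J z.
Proof.
have n0 : (0 < n)%N by exact: leq_ltn_trans rn.
have c00 : c 0 = 0%N := c_0 r_gt0 rn.
(* Coordinate number [lbl i q] of the factor [i.-1] sits in row [i] of the slice matrix, in column
   [l i + lbl i q] counted from 1, hence the predecessor in [Jn]. *)
pose lbl (i q : nat) : nat :=
  if insub i.-1 is Some i' then (inord (J i' q) : 'I_(m i').+1) else 0%N.
pose Jn (i q : nat) : nat := (l i + lbl i q).-1.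
have JP i q : (0 < i < r)%N -> (q < c i)%N -> (l i <= (Jn i q).+1)%N /\ (Jn i q < a i)%N.
  move=> /andP[i0 ir] qc; have := lb (i := i); rewrite i0 ir => /(_ isT).
  suff : (lbl i q <= a i - l i)%N by rewrite /Jn; lia.
  have ir' : (i.-1 < r - 1)%N by lia.
  rewrite /lbl (insubT (fun x => x < r - 1)%N ir') /=.
  by apply: leq_trans (leq_ord _) _; rewrite /m /slice_dim /= prednK.
have /choice[t tE] : forall iq : 'I_r * 'I_n, exists j : 'I_n,
    j = tableau r n Jn iq.1 iq.2 :> nat.
  move=> [i q]; have lt : (tableau r n Jn i q < n)%N.
    apply: leq_trans (tableau_lt r_gt0 rn lb JP (ltn_ord i) (ltn_ord q)) _.
    by have := a_mono r_gt0 rn (ltn_ord i); rewrite a_r.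
  by exists (Ordinal lt).
pose F (A : grassmannian K r n) := \prod_(q < n) \det (colsub (fun i => t (i, q)) (sval A)).
have hF : homog (n * 1)%N F.
  have -> : (n * 1 = \sum_(q < n) 1)%N by rewrite sum1_card card_ord muln1.
  apply: generated_prod => q _; apply: gen_base; split=> //.
  exists (fun i => t (i, q)); split=> // i i' ii'; rewrite !tE /=.
  exact: (tableau_mono r_gt0 rn lb JP).
exists (F \o sval); split.
  split.
    apply: twist_homog; first exact/graded_sub/graded_grassmannian.
      exact/zopenT/graded_sub/graded_grassmannian.
    by exists F.
  move=> tau x y tT E; rewrite /F /=.
  have -> : sval (sval y) = sval (sval x) *m diag_mx tau by exact: E.
  under eq_bigr => q _.
    have -> : colsub (fun i => t (i, q)) (sval (sval x) *m diag_mx tau) =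
      colsub (fun i => t (i, q)) (sval (sval x)) *m diag_mx (\row_i tau 0 (t (i, q))).
      by apply/matrixP => i j; rewrite mul_mx_diag mxE mul_mx_diag !mxE.
    rewrite det_mulmx det_diag; over.
  rewrite big_split /= -[RHS]mulr1; congr (_ * _).
  pose f (j : nat) : K := if insub j is Some j' then tau 0 j' else 1.
  have fE (j : 'I_n) : tau 0 j = f j by rewrite /f valK.
  have := tableau_content r_gt0 rn lb JP f.
  have -> : \prod_(0 <= j < n) f j = 1.
    by rewrite big_mkord -[RHS]tT; apply: eq_bigr => j _; rewrite fE.
  rewrite expr1n big_mkord => E'; rewrite -{}[RHS]E'.
  under [RHS]eq_bigr do rewrite big_mkord.
  rewrite exchange_big /=; apply: eq_bigr => q _; apply: eq_bigr => i _.
  by rewrite mxE fE tE.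
move=> z; rewrite /F /=.
under eq_bigr => q _ do rewrite (@det_tableau Jn z (fun i => t (i, q)) q JP (ltn_ord q) (fun i => tE (i, q))).
rewrite exchange_big /=.
pose G (i : nat) : K := \prod_(q < c i) coef z i.-1 (lbl i q).
have rowE (i : 'I_r) : \prod_(q < n) slice_mx z i (t (i, q)) = G i.
  have cn : (c i <= n)%N by apply: leq_trans (ltnW rn); rewrite ltnW // c_lt.
  rewrite /G (big_ord_widen n (fun q => coef z i.-1 (lbl i q)) cn) [RHS]big_mkcond /=.
  apply: eq_bigr => q _; rewrite mxE !tE /=.
  case: (ltnP q (c i)) => qc.
    rewrite tableau_overlap //.
    have i0 : (0 < i)%N by rewrite lt0n; apply: contraTneq qc => ->; rewrite c00.
    have ir : (0 < i < r)%N by rewrite i0 ltn_ord.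
    have [h1 h2] := JP _ _ ir qc.
    have -> : (a i <= Jn i q < a i.+1)%N = false by lia.
    have -> : window r n l i (Jn i q).
      rewrite /window /v_; move: i0 h1 h2; have := a_ltS r_gt0 rn i; rewrite -/a.
      by case: (nat_of_ord i) => //= i1; lia.
    congr coef; rewrite /Jn; have := lb (i := i); rewrite i0 ltn_ord => /(_ isT); lia.
  by have := @tableau_block r n r_gt0 rn l lb Jn JP i q (ltn_ord i); rewrite qc ltn_ord => /(_ isT) ->.
rewrite (eq_bigr (fun i : 'I_r => G i)) => [|i _]; last exact: rowE.
rewrite -(big_mkord xpredT G) -{1}(prednK r_gt0) big_nat_recl // {1}/G c00 big_ord0 mul1r.
rewrite -subn1 big_mkord /sv; apply: eq_bigr => i _; apply: eq_bigr => q _.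
rewrite /lbl /= valK slice_coefE; congr (z i 0 _); exact: inord_val.
Qed.

End Sections.

(** * Restriction of sections to the slice *)

Section PolynomialFunctions.
Variables (K : closedFieldType) (k : nat) (m : 'I_k -> nat).
Let VV := affine_space K m.

Definition polyfun (F : VV -> K) : Prop :=
  exists (I : finType) (e : I -> {ffun 'I_k -> nat}) (f : I -> VV -> K),
    (forall i, multihomog (e i) (f i)) /\ F = (fun z => \sum_i f i z).

Lemma polyfun_homog e F : multihomog e F -> polyfun F.
Proof.
move=> hF; exists unit, (fun=> e), (fun=> F); split=> //.
by apply: funext => z; rewrite (bigD1 tt) //= big1 ?addr0 // => -[].
Qed.

Lemma polyfun_const c : polyfun (fun=> c).
Proof. exact: polyfun_homog (gen_const _ c). Qed.

Lemma polyfunD F G : polyfun F -> polyfun G -> polyfun (fun z => F z + G z).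
Proof.
move=> [I [e [f [hf ->]]]] [I' [e' [f' [hf' ->]]]].
exists (I + I')%type, (fun i => match i with inl i => e i | inr i => e' i end),
  (fun i => match i with inl i => f i | inr i => f' i end); split; first by case.
by apply: funext => z; rewrite big_sumType.
Qed.

Lemma polyfunM F G : polyfun F -> polyfun G -> polyfun (fun z => F z * G z).
Proof.
move=> [I [e [f [hf ->]]]] [I' [e' [f' [hf' ->]]]].
exists (I * I')%type, (fun i => e i.1 + e' i.2), (fun i z => f i.1 z * f' i.2 z); split.
  by move=> i; apply: gen_mul; [exact: hf|exact: hf'].

apply: funext => z; rewrite big_distrl /=; under eq_bigr do rewrite big_distrr /=.
by rewrite pair_big.
Qed.

Lemma polyfun_sum (I : Type) (s : seq I) (F : I -> VV -> K) :
  (forall i, polyfun (F i)) -> polyfun (fun z => \sum_(i <- s) F i z).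
Proof.
move=> H; elim: s => [|i s IH].
  by under [X in polyfun X]eq_fun do rewrite big_nil; exact: polyfun_const.
by under [X in polyfun X]eq_fun do rewrite big_cons; exact: polyfunD.
Qed.

Lemma polyfun_prod (I : Type) (s : seq I) (F : I -> VV -> K) :
  (forall i, polyfun (F i)) -> polyfun (fun z => \prod_(i <- s) F i z).
Proof.
move=> H; elim: s => [|i s IH].
  by under [X in polyfun X]eq_fun do rewrite big_nil; exact: polyfun_const.
by under [X in polyfun X]eq_fun do rewrite big_cons; exact: polyfunM.
Qed.

Lemma weight_single (i0 : 'I_k) lam (e : {ffun 'I_k -> nat}) :
  weight (fun i => if i == i0 then lam else 1 : K) e = lam ^+ e i0.
Proof.
rewrite /weight (bigD1 i0) //= eqxx big1 ?mulr1 // => i ne.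
by rewrite (negbTE ne) expr1n.
Qed.

Lemma multihomog_zero e (f : VV -> K) (z0 := (fun=> 0) : VV) z : multihomog e f ->
  f z0 = if e == 0 then f z else 0.
Proof.
move=> hf; have -> : z0 = scale (fun=> 0) z.
  by apply: functional_extensionality_dep => i; rewrite /scale scale0r.
rewrite (multihomog_scale _ _ hf); case: eqVneq => [->|e0]; first by rewrite weight0 mul1r.
suff /existsP[i ei] : [exists i, e i != 0%N].
  by rewrite /weight (bigD1 i) //= expr0n (negbTE ei) !mul0r.
apply: contraR e0; rewrite negb_exists => /forallP H; apply/eqP/ffunP => i.
by have := H i; rewrite ffunE negbK => /eqP.
Qed.

(* A semi-invariant quotient of polynomial functions, with denominator not
   vanishing at the origin, is a polynomial: compare the coefficients of
   [lam ^+ D i] in [phi (lam z) * G (lam z) = F (lam z)], one factor at a time. *)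
Lemma semiinvariant_multihomog (phi F G : VV -> K) (D : {ffun 'I_k -> nat}) :
  (forall i0 lam z, lam != 0 ->
     phi (scale (fun i => if i == i0 then lam else 1) z) = lam ^+ D i0 * phi z) ->
  polyfun F -> polyfun G -> G (fun=> 0) != 0 ->
  (forall z, phi z * G z = F z) -> multihomog D phi.
Proof.
move=> phiS [I [e [f [hf ->]]]] [I' [e' [g [hg ->]]]] G0 E.
(* For the groups [s] in [S], only summands of degree 0 on the side of [g] and of degree [D s] on
   that of [f] are kept. Once [S] contains all groups, the sum over [g] is constant, equal to its
   value at the origin. *)
have key (S : seq 'I_k) z :
    phi z * (\sum_(i | all (fun s => e' i s == 0%N) S) g i z) =
    \sum_(i | all (fun s => e i s == D s) S) f i z.
  elim: S z => [|s S IH] z; first exact: E.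
  pose p : {poly K} := \sum_(i | all (fun s => e' i s == 0%N) S) (phi z * g i z)%:P * 'X^(D s + e' i s)%N.
  pose q : {poly K} := \sum_(i | all (fun s => e i s == D s) S) (f i z)%:P * 'X^(e i s).
  have pq : p = q.
    apply: poly_eq_nonzero => lam lam0; rewrite !horner_sum.
    have := IH (scale (fun i => if i == s then lam else 1) z); rewrite phiS //.
    under eq_bigr => i _ do rewrite (multihomog_scale _ _ (hg i)) weight_single.
    under [X in _ = X -> _]eq_bigr => i _ do rewrite (multihomog_scale _ _ (hf i)) weight_single.
    move=> E'; under [RHS]eq_bigr => i _ do rewrite hornerM hornerC hornerXn mulrC.
    rewrite -E' mulr_sumr; apply: eq_bigr => i _.
    by rewrite hornerM hornerC hornerXn exprD; ring.
  have := congr1 (fun p : {poly K} => p`_(D s)) pq; rewrite /p /q !coef_sum.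
  move=> E'; rewrite mulr_sumr /=.
  transitivity (\sum_(i | all (fun s => e' i s == 0%N) S)
    ((phi z * g i z)%:P * 'X^(D s + e' i s)%N)`_(D s)).
    rewrite [RHS]big_mkcond /= [LHS]big_mkcond /=; apply: eq_bigr => i _.
    have Ee : (D s == D s + e' i s)%N = (e' i s == 0%N).
      by rewrite -{1}[D s]addn0 eqn_add2l eq_sym.
    rewrite coefCM coefXn Ee.
    by case: all; case: (e' i s == 0%N); rewrite ?mulr1 ?mulr0.
  rewrite E' [LHS]big_mkcond [RHS]big_mkcond /=; apply: eq_bigr => i _.
  rewrite coefCM coefXn [D s == _]eq_sym.
  by case: all; case: (e i s == D s); rewrite ?mulr1 ?mulr0.
pose G0v := \sum_i g i (fun=> 0).
have phiE z : phi z = G0v^-1 * \sum_(i | all (fun s => e i s == D s) (enum 'I_k)) f i z.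
  rewrite -key; have -> : \sum_(i | all (fun s => e' i s == 0%N) (enum 'I_k)) g i z = G0v.
    rewrite /G0v big_mkcond /=; apply: eq_bigr => i _; rewrite (multihomog_zero z (hg i)).
    congr (if _ then _ else _); apply/allP/eqP => [H|-> s _]; last by rewrite ffunE.
    by apply/ffunP => s; rewrite ffunE; apply/eqP/H; rewrite mem_enum.
  by rewrite mulrC mulfK.
have -> : phi = (fun z => G0v^-1 * \sum_(i | all (fun s => e i s == D s) (enum 'I_k)) f i z).
  exact: funext.
rewrite -[D]add0r; apply: gen_mul; first exact: gen_const.
apply: generated_sum => i /allP H.
have -> : D = e i; last exact: hf.
apply/ffunP => s; apply/esym/eqP; have := H s; rewrite add0r; apply; exact: mem_enum.
Qed.

End PolynomialFunctions.

Section SectionsOnSlice.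
Variables (K : closedFieldType) (r n : nat).
Hypotheses (r_gt0 : (0 < r)%N) (rn : (r < n)%N).
Variable l : nat -> nat.
Let a := a_ r n.
Hypothesis lb : forall i, (0 < i < r)%N -> (a i.-1 + 2 <= l i <= a i)%N.

Let X : set (grassmannian K r n) := richardson (v_ l) a.
Let m := @slice_dim r n l.
Let deg := @slice_deg r n.
Let sl (z : affine_space K m) : subvariety X := slice r_gt0 rn lb z.

Lemma polyfun_slice d (F : grassmannian K r n -> K) :
  homog d F -> polyfun (fun z : affine_space K m => F (sval (sl z))).
Proof.
elim=> {d F}.
- exact: polyfun_const.
- move=> d _ [_ [t [_ ->]]]; apply: polyfun_sum => s; apply: polyfunM.
    exact: polyfun_const.
  apply: polyfun_prod => i /=; under [X in polyfun X]eq_fun do rewrite !mxE.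
  case: (_ <= _ < _)%N; first exact: polyfun_const.
  case: (window _ _ _ _ _); last exact: polyfun_const.
  rewrite /coef; case: insubP => [i' _ _|_]; last exact: polyfun_const.
  by apply: (@polyfun_homog _ _ _ (unit_degree i')); apply: gen_base; do 2 eexists; split.
- move=> d; exact: polyfun_const.
- by move=> d f g _ hf _ hg; exact: polyfunD.
- by move=> d e f g _ hf _ hg; exact: polyfunM.
Qed.

Lemma section_multihomog d (s : subvariety X -> K) : inv_sections d s ->
  multihomog [ffun i => (d * deg i)%N] (s \o sl).
Proof.
move=> sd; pose z0 : affine_space K m := fun=> 0.
have [V [oV Vy _ [b [F [G [[F' hF' FE] [G' hG' GE] FG]]]]]] := sd.1 (sl z0) I.
have [b' [H [[H' hH' HE] Hy HV]]] := oV _ Vy.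
(* [F / G] represents [s] near the origin of the slice, where [H] is nonzero. The factor [H] on both
   sides makes the identity hold on the whole slice. *)
apply: (@semiinvariant_multihomog _ _ _ _ (fun z => F' (sval (sl z)) * H' (sval (sl z)))
  (fun z => G' (sval (sl z)) * H' (sval (sl z)))).
- by move=> i0 lam z lam0; rewrite ffunE /=; exact: slice_scale.
- by apply: polyfunM; apply: polyfun_slice; eassumption.
- by apply: polyfunM; apply: polyfun_slice; eassumption.
- have [Gy _] := FG _ Vy; rewrite GE /= in Gy; rewrite HE /= in Hy.
  by rewrite mulf_neq0.
- move=> z; have [->|Hz] := eqVneq (H' (sval (sl z))) 0; first by rewrite !mulr0.
  have [Gz sE] : G (sl z) != 0 /\ s (sl z) = F (sl z) / G (sl z) by apply/FG/HV; rewrite /= HE.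
  by rewrite /= sE FE GE /= in Gz *; field.
Qed.

End SectionsOnSlice.

(** * Extraction of monomial factors from multihomogeneous functions *)

Section Splitting.
Variables (K : closedFieldType) (k : nat) (m : 'I_k -> nat).
Let VV := affine_space K m.

Lemma unit_degreeK (d : {ffun 'I_k -> nat}) i : (0 < d i)%N ->
  d = unit_degree i + [ffun j => (d j - (j == i))%N].
Proof.
move=> di; apply/ffunP => j; rewrite !ffunE; case: eqVneq => [->|_] /=.
  by rewrite (_ : _ + _ = (1 + (d i - 1))%N :> nat) // subnKC.
by rewrite subn0 add0r.
Qed.

Lemma multihomog_split d (F : VV -> K) i e : multihomog d F -> d = unit_degree i + e ->
  exists Fj : 'I_(m i).+1 -> VV -> K,
    (forall j, multihomog e (Fj j)) /\ F = (fun z => \sum_j z i 0 j * Fj j z).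
Proof.
have eq_at (d1 d2 : {ffun 'I_k -> nat}) j : d1 = d2 -> d1 j = d2 j by move->.
have addE (d1 d2 : {ffun 'I_k -> nat}) j : (d1 + d2) j = (d1 j + d2 j)%N by rewrite ffunE.
move=> hF; elim: hF i e => {d F}.
- by move=> c i e /(eq_at _ _ i); rewrite addE !ffunE eqxx.
- move=> d _ [i' [j' [-> ->]]] i e E.
  have ii' : i = i'.
    have := eq_at _ _ i E; rewrite addE !ffunE eqxx.
    by case: eqVneq.
  subst i'; have -> : e = 0.
    apply/ffunP => j; have /eqP := eq_at _ _ j E.
    by rewrite addE !ffunE -{1}[nat_of_bool _]addn0 eqn_add2l => /eqP <-.
  exists (fun j _ => (j == j')%:R); split; first by move=> j; exact: gen_const.
  apply: funext => z; rewrite (bigD1 j') //= eqxx mulr1 big1 ?addr0 // => j ne.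
  by rewrite (negbTE ne) mulr0.
- move=> d i e E; exists (fun _ _ => 0); split; first by move=> j; exact: gen_zero.
  by apply: funext => z; rewrite big1 // => j _; rewrite mulr0.
- move=> d f g _ IHf _ IHg i e E.
  have [Fj [hF ->]] := IHf _ _ E; have [Gj [hG ->]] := IHg _ _ E.
  exists (fun j z => Fj j z + Gj j z); split.
    by move=> j; apply: gen_add; [exact: hF|exact: hG].
  by apply: funext => z; rewrite -big_split; apply: eq_bigr => j _; rewrite mulrDr.
- move=> /= d1' d2' f g; pose d1 : {ffun 'I_k -> nat} := d1'.
  pose d2 : {ffun 'I_k -> nat} := d2'; rewrite -[d1']/d1 -[d2']/d2.
  move: d1 d2 => d1 d2 {d1' d2'} hf IHf hg IHg i e E.
  have [d1i|d1i] := posnP (d1 i).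
    have d2i : (0 < d2 i)%N by have := eq_at _ _ i E; rewrite !addE ffunE eqxx d1i; lia.
    have [Gj [hG ->]] := IHg _ _ (unit_degreeK d2i).
    exists (fun j z => f z * Gj j z); split.
      move=> j; have -> : e = d1 + [ffun j => (d2 j - (j == i))%N].
        apply/ffunP => j'; have := eq_at _ _ j' E; rewrite !addE !ffunE.
        by case: eqVneq => [->|_] /=; lia.
      by apply: gen_mul => //; exact: hG.
    by apply: funext => z; rewrite mulr_sumr; apply: eq_bigr => j _; rewrite mulrCA.
  have [Fj [hF ->]] := IHf _ _ (unit_degreeK d1i).
  exists (fun j z => Fj j z * g z); split.
    move=> j; have -> : e = [ffun j => (d1 j - (j == i))%N] + d2.
      apply/ffunP => j'; have := eq_at _ _ j' E; rewrite !addE !ffunE.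
      by case: eqVneq => [->|_] /=; lia.
    by apply: gen_mul => //; exact: hF.
  by apply: funext => z; rewrite mulr_suml; apply: eq_bigr => j _; rewrite mulrA.
Qed.

(** [Q] is arbitrary so that the induction can absorb an extracted coordinate: the induction
    hypothesis is applied to the predicate [Q (z i 0 j * H z)] of [H]. *)
Lemma multihomog_slots_ind (L : seq ('I_k * nat)) e (F : VV -> K) (Q : (VV -> K) -> Prop) :
  uniq L -> Q (fun=> 0) -> (forall G H, Q G -> Q H -> Q (fun z => G z + H z)) ->
  (forall (J : labels k) G, multihomog e G ->
     Q (fun z => (\prod_(p <- L) z p.1 0 (inord (J p.1 p.2))) * G z)) ->
  multihomog (\sum_(p <- L) unit_degree p.1 + e) F -> Q F.
Proof.
elim: L F Q => [|[i q] L IH] F Q /=.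
  move=> _ _ _ QL; rewrite big_nil add0r => hF.
  have := QL (fun _ _ => 0%N) F hF; congr Q; apply: funext => z.
  by rewrite big_nil mul1r.
move=> /andP[nin uL] Q0 QD QL; rewrite big_cons /= -addrA => hF.
have [Fj [hFj ->]] := multihomog_split hF erefl.
have QS (s : seq 'I_(m i).+1) : (forall j, Q (fun z => z i 0 j * Fj j z)) ->
    Q (fun z => \sum_(j <- s) z i 0 j * Fj j z).
  move=> H; elim: s => [|j s IHs].
    by move: Q0; congr Q; apply: funext => z; rewrite big_nil.
  by have := QD _ _ (H j) IHs; congr Q; apply: funext => z; rewrite big_cons.
apply: QS => j; apply: (IH (Fj j) (fun H => Q (fun z => z i 0 j * H z))) => //.
- by move: Q0; congr Q; apply: funext => z; rewrite mulr0.
- by move=> G H QG QH; have := QD _ _ QG QH; congr Q; apply: funext => z; rewrite mulrDr.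
- move=> J G hG; have := QL (upd J i q j) G hG; congr Q; apply: funext => z.
  rewrite big_cons /= upd_same inord_val -!mulrA; congr (_ * (_ * _)).
  apply: eq_big_seq => -[i' q'] pL /=; rewrite /upd.
  by case: andP => // -[/eqP ei /eqP eq]; case/negP: nin; rewrite -ei -eq.
Qed.

(** The section ring of the product is generated in degree 1, in the form of an induction principle
    on sums of multiples of the monomials [sv c J]. *)
Lemma multihomog_sv_ind (c : 'I_k -> nat) e (F : VV -> K) (Q : (VV -> K) -> Prop) :
  Q (fun=> 0) -> (forall G H, Q G -> Q H -> Q (fun z => G z + H z)) ->
  (forall J G, multihomog e G -> Q (fun z => sv c J z * G z)) ->
  multihomog ([ffun i => c i] + e) F -> Q F.
Proof.
move=> Q0 QD QJ hF.
pose L := [seq (i, nat_of_ord q) | i <- enum 'I_k, q <- enum 'I_(c i)].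
apply: (@multihomog_slots_ind L e F Q) => //.
- apply: allpairs_uniq_dep; first exact: enum_uniq.
    by move=> i _; exact: enum_uniq.
  by move=> [i q] [i' q'] _ _ /= [ei]; case: _ / ei q' => q' /val_inj ->.
- move=> J G hG; have := QJ J G hG; congr Q; apply: funext => z; congr (_ * _).
  rewrite big_allpairs_dep /= [RHS]big_enum /=; apply: eq_bigr => i _.
  by rewrite [RHS]big_enum.
- suff <- : [ffun i => c i] = \sum_(p <- L) unit_degree p.1 by [].
  rewrite big_allpairs_dep /= [RHS]big_enum /=.
  under [RHS]eq_bigr do rewrite big_enum /=.
  exact: slots_degree.
Qed.

End Splitting.

(** * The quotient *)

Section Quotient.
Variables (K : closedFieldType) (r n : nat).
Hypotheses (r_gt0 : (0 < r)%N) (rn : (r < n)%N).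
Variable l : nat -> nat.
Let a := a_ r n.
Hypothesis lb : forall i, (0 < i < r)%N -> (a i.-1 + 2 <= l i <= a i)%N.

Let X : set (grassmannian K r n) := richardson (v_ l) a.
Let m := @slice_dim r n l.
Let deg := @slice_deg r n.
Let sl (z : affine_space K m) : subvariety X := slice r_gt0 rn lb z.
Let R := @inv_sections K r n X.

Let gX : graded (subvariety X) := graded_sub X (graded_grassmannian K r n).

Lemma homogX_D d (f g : subvariety X -> K) :
  homog d f -> homog d g -> homog d (fun x => f x + g x).
Proof.
move=> [F hF ->] [G hG ->]; exists (fun x => F x + G x) => //; exact: gen_add.
Qed.

Lemma inv_sections_const c : R 0 (fun=> c).
Proof.
split=> //; rewrite muln0; apply: twist_homog => //; first exact: zopenT.
by exists (fun=> c) => //; exact: gen_const.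
Qed.

Lemma inv_sections0 d : R d (fun=> 0).
Proof.
split=> //; apply: twist_homog => //; first exact: zopenT.
by exists (fun=> 0) => //; exact: gen_zero.
Qed.

Lemma inv_sectionsD d f g : R d f -> R d g -> R d (fun x => f x + g x).
Proof.
move=> [tf If] [tg Ig]; split; first exact: (twistD gX homogX_D).
by move=> t x y tT xy; rewrite (If t x y) ?(Ig t x y).
Qed.

Lemma inv_sectionsM d e f g : R d f -> R e g -> R (d + e)%N (fun x => f x * g x).
Proof.
move=> [tf If] [tg Ig]; split; first by rewrite mulnDr; exact: twistM.
by move=> t x y tT xy; rewrite (If t x y) ?(Ig t x y).
Qed.

Lemma graded_git : graded (git_quotient X).
Proof. by apply: graded_Proj; [exact: inv_sections_const|exact: inv_sectionsM]. Qed.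

Section ProjPoint.
Variable p : git_quotient X.

Lemma proj_eval1 : p 0%N (fun=> 1) = 1. Proof. by case: p. Qed.

Lemma proj_evalM d e f g : R d f -> R e g -> p (d + e)%N (fun x => f x * g x) = p d f * p e g.
Proof. by move: f g; case: p => q /= _ _ H _ f g; exact: H. Qed.

Lemma proj_evalL d c f g : R d f -> R d g -> p d (fun x => c * f x + g x) = c * p d f + p d g.
Proof. by move: f g; case: p => q /= _ H _ _ f g; exact: H. Qed.

Lemma proj_evalD d f g : R d f -> R d g -> p d (fun x => f x + g x) = p d f + p d g.
Proof.
move=> Rf Rg; rewrite -[p d f]mul1r -proj_evalL //; congr (p d _).
by apply: funext => x; rewrite mul1r.
Qed.

Lemma proj_eval0 d : p d (fun=> 0) = 0.
Proof.
have /esym := proj_evalD (inv_sections0 d) (inv_sections0 d).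
under [X in _ = p d X -> _]eq_fun do rewrite addr0.
by rewrite -[RHS]addr0 => /addrI.
Qed.

Lemma proj_evalC c : p 0%N (fun=> c) = c.
Proof.
have := proj_evalL c (inv_sections_const 1) (inv_sections0 0).
rewrite proj_eval1 proj_eval0 addr0 mulr1 => E; rewrite -[RHS]E; congr (p _ _).
Qed.

Lemma proj_eval_nonzero : exists d f, [/\ (0 < d)%N, R d f & p d f != 0].
Proof. by case: p. Qed.

End ProjPoint.

Hypothesis cop : coprime r n.

Variable sg : labels (r - 1) -> subvariety X -> K.
Hypothesis sgP : forall J, R 1 (sg J) /\ forall z, sg J (sl z) = sv deg J z.

Lemma deg_gt0 i : (0 < deg i)%N.
Proof. by apply: c_gt0 => //=; have := ltn_ord i; lia. Qed.

Lemma slice_semistable z : (forall i, z i != 0) -> semistable (sl z).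
Proof.
move=> z0; have [J HJ] := sv_neq0 deg z0.
by exists 1%N, (sg J); split; [|exact: (sgP J).1|rewrite (sgP J).2].
Qed.

(** Every semistable point is equivalent to a slice point, and outside the semistable locus all
    invariant sections of positive degree vanish by definition. *)
Lemma inv_sections_eq d s s' : (0 < d)%N -> R d s -> R d s' ->
  (forall z, s (sl z) = s' (sl z)) -> s = s'.
Proof.
move=> d0 Rs Rs' E; apply: funext => x; have [ssx|nss] := EM (semistable x).
  have [z _ [b b0 H]] := semistable_slice r_gt0 rn lb cop ssx.
  by rewrite (H d s Rs) (H d s' Rs') E.
have nz t : R d t -> t x = 0.
  move=> Rt; apply/eqP; apply: contrapT => /negP tx; apply: nss.
  by exists d, t.
by rewrite !nz.
Qed.

(* For [b = 0] this says that a point at which all the [sg J] vanish kills all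
   sections of positive degree. *)
Lemma multihomog_section (p : git_quotient X) b x d F :
  (forall J, p 1%N (sg J) = b * sv deg J x) ->
  multihomog [ffun i => (d * deg i)%N] F ->
  exists h, [/\ R d h, forall z, h (sl z) = F z & p d h = b ^+ d * F x].
Proof.
move=> pE; elim: d F => [|d IH] F hF.
  have Fc z : F z = F (fun=> 0).
    have e0 : [ffun i => (0 * deg i)%N] = 0 :> {ffun 'I_(r - 1) -> nat}.
      by apply/ffunP => i; rewrite !ffunE mul0n.
    by rewrite e0 in hF; rewrite (multihomog_zero z hF) eqxx.
  exists (fun=> F (fun=> 0)); split; [exact: inv_sections_const|by []|].
  by rewrite proj_evalC expr0 mul1r Fc.
move: hF; have -> : [ffun i => (d.+1 * deg i)%N] = [ffun i => deg i] + [ffun i => (d * deg i)%N].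
  by apply/ffunP => i; rewrite !ffunE mulSn.
apply: (@multihomog_sv_ind _ _ _ deg _ F (fun F => exists h,
  [/\ R d.+1 h, forall z, h (sl z) = F z & p d.+1 h = b ^+ d.+1 * F x])).
- exists (fun=> 0); split; [exact: inv_sections0|by []|by rewrite proj_eval0 mulr0].
- move=> G H [g [Rg gE pg]] [h [Rh hE ph]]; exists (fun x => g x + h x); split.
  + exact: inv_sectionsD.
  + by move=> z; rewrite gE hE.
  + by rewrite proj_evalD // pg ph mulrDr.
- move=> J G /IH[h [Rh hE ph]]; exists (fun x => sg J x * h x); split.
  + exact: (inv_sectionsM (sgP J).1 Rh).
  + by move=> z; rewrite (sgP J).2 hE.
  + by rewrite (proj_evalM p (sgP J).1 Rh) pE ph exprS mulrACA.
Qed.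

Lemma proj_eval_slice (p : git_quotient X) b x d h : b != 0 -> (forall i, x i != 0) ->
  (forall J, p 1%N (sg J) = b * sv deg J x) -> R d h -> p d h = b ^+ d * h (sl x).
Proof.
move=> b0 x0 pE.
have pos d' h' : (0 < d')%N -> R d' h' -> p d' h' = b ^+ d' * h' (sl x).
  move=> d0 Rh'; have := section_multihomog r_gt0 rn lb Rh'.
  move=> /(multihomog_section pE)[h'' [Rh'' hE ph]].
  by rewrite (inv_sections_eq d0 Rh' Rh'' (fun z => esym (hE z))) ph hE.
(* The slice determines sections of positive degree only; in degree 0, multiply by a degree 1
   section that does not vanish at [p]. *)
case: d h => [|d] h Rh; last exact: pos.
have [J HJ] := sv_neq0 deg x0; rewrite expr0 mul1r.
have pJ : p 1%N (sg J) != 0 by rewrite pE mulf_neq0.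
apply: (mulIf pJ); rewrite -(proj_evalM p Rh (sgP J).1).
by rewrite pos //; [rewrite expr1 pE (sgP J).2 mulrCA|exact: (inv_sectionsM Rh (sgP J).1)].
Qed.

Lemma proj_generated (p : git_quotient X) : exists J, p 1%N (sg J) != 0.
Proof.
apply: contrapT => nex; have [d [h [d0 Rh]]] := proj_eval_nonzero p; case/negP.
have pE J : p 1%N (sg J) = 0 * sv deg J ((fun=> 0) : affine_space K m).
  by rewrite mul0r; apply/eqP; apply: contrapT => /negP H; apply: nex; exists J.
have /(multihomog_section pE)[h' [Rh' hE]] := section_multihomog r_gt0 rn lb Rh.
rewrite (inv_sections_eq d0 Rh Rh' (fun z => esym (hE z))) => ->.
by rewrite expr0n gtn_eqF // mul0r.
Qed.

(** The relations hold between the sections [sg J] themselves, because they hold on the slice, and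
    [p] is multiplicative. *)
Lemma proj_segre (p : git_quotient X) : segre_rel m deg (fun J => p 1%N (sg J)).
Proof.
have sgE J J' : (forall z : affine_space K m, sv deg J z = sv deg J' z) -> sg J = sg J'.
  move=> E; apply: (inv_sections_eq (isT : (0 < 1)%N) (sgP J).1 (sgP J').1) => z.
  by rewrite (sgP J).2 (sgP J').2 E.
split.
- move=> J J' JJ'; rewrite (@sgE J J') // => z; exact: sv_ext.
- move=> J J' i q qi; rewrite -!(proj_evalM p (sgP _).1 (sgP _).1); congr (p _ _).
  apply: (@inv_sections_eq (1 + 1)) => //; try exact: (inv_sectionsM (sgP _).1 (sgP _).1).
  by move=> z; rewrite !(sgP _).2 (segre_exch (sv_rel deg_gt0 z) _ _ qi).
- move=> J i q qi; rewrite (sgE _ J) // => z.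
  exact: (segre_sym (sv_rel deg_gt0 z)).
Qed.

Variables (N : nat) (dec : 'I_N.+1 -> labels (r - 1)) (enc : labels (r - 1) -> 'I_N.+1).
Hypothesis decK : forall J, slots_eq m deg (dec (enc J)) J.

Let P := prod_proj K m.

Definition git_vec (p : git_quotient X) : affine_space K (fun _ : 'I_1 => N) :=
  fun _ => \row_j p 1%N (sg (dec j)).

Lemma git_vecE p J : git_vec p 0 0 (enc J) = p 1%N (sg J).
Proof. by rewrite mxE; apply: (segre_ext (proj_segre p)). Qed.

Lemma git_vec_neq0 p i : git_vec p i != 0.
Proof.
have [J HJ] := proj_generated p; apply/rV0Pn; exists (enc J).
by rewrite (ord1 i) git_vecE.
Qed.

Definition git_proj (p : git_quotient X) : proj_space K N :=
  exist (fun x : affine_space K (fun _ : 'I_1 => N) => forall i, x i != 0) _ (git_vec_neq0 p).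

Lemma git_proj_image p : veronese_image decK (git_proj p).
Proof.
have [J HJ] := proj_generated p.
have [x x0 [b b0 E]] := sv_surj deg_gt0 (proj_segre p) HJ.
exists (exist _ x x0); apply: (@same_pt_proj _ _ _ _ b^-1); first by rewrite invr_eq0.
by move=> j; rewrite !mxE E mulKf.
Qed.

Definition git_image (p : git_quotient X) : subvariety (veronese_image decK) :=
  exist _ (git_proj p) (git_proj_image p).

Lemma git_image_morphism : is_morphism git_image.
Proof.
apply: (morphism_local graded_git).
  move=> p q [b b0 E]; apply: (@same_pt_proj _ _ _ _ b^-1); first by rewrite invr_eq0.
  by move=> j; rewrite !mxE (E _ _ (sgP _).1) expr1 mulKf.
move=> p0; exists setT, (fun e : {ffun 'I_1 -> nat} => e ord0), (fun _ _ => 1); split=> //.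
- exact: (zopenT graded_git).
- by move=> *; exact: oner_neq0.
- move=> e _ [h /homog_multihomog[H hH ->] ->]; exists (H \o git_vec); split.
    apply: (twist_homog graded_git (zopenT graded_git)).
    pose C d (f : git_quotient X -> K) := homog d f.
    apply: (@generated_comp K {ffun 'I_1 -> nat} nat _ (coords (git_quotient X))
      (@coord_fun K 1 (fun _ => N)) git_vec (fun e : {ffun 'I_1 -> nat} => e ord0) C) hH.
    + by rewrite ffunE.
    + by move=> d d'; rewrite ffunE.
    + move=> c; exists (fun=> c); first exact: inv_sections_const.
      by apply: funext => p; rewrite proj_evalC.
    + move=> d; exists (fun=> 0); first exact: inv_sections0.
      by apply: funext => p; rewrite proj_eval0.
    + move=> d _ _ [f Rf ->] [g Rg ->]; exists (fun x => f x + g x).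
        exact: inv_sectionsD.
      by apply: funext => p; rewrite proj_evalD.
    + by move=> d d' f g hf hg; exact: (homogM graded_git hf hg).
    + move=> _ _ [i [j [-> ->]]]; rewrite /C ffunE (ord1 i) eqxx.
      exists (sg (dec j)); first exact: (sgP _).1.
      by apply: funext => p; rewrite /= mxE.
  by move=> x _; rewrite mul1r.
Qed.

Definition git_to_prod (p : git_quotient X) : P := veronese_inv (git_image p).

Definition prod_to_git (z : P) : git_quotient X :=
  quotient_map (exist _ (sl (sval z)) (slice_semistable (svalP z)) : ss_locus X).

Lemma git_to_prod_scale p : exists2 b : K, b != 0 &
  forall J, sv deg J (sval (git_to_prod p)) = b * p 1%N (sg J).
Proof.
have [b b0 E] := proj_same_pt (veronese_invP (git_image p)).
by exists b => // J; rewrite -git_vecE -E veronese_vecE.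
Qed.

Lemma section_scale d h b z : R d h ->
  h (sl (scale b z)) = weight b [ffun i => deg i] ^+ d * h (sl z).
Proof.
move=> /(section_multihomog r_gt0 rn lb) hM.
have := multihomog_scale b z hM; rewrite /= => ->; congr (_ * _).
rewrite /weight -prodrXl; apply: eq_bigr => i _.
by rewrite !ffunE mulnC exprM.
Qed.

Lemma prod_to_git_morphism : is_morphism prod_to_git.
Proof.
have gP := graded_prod_proj K m.
apply: (morphism_local gP).
  move=> x y /prod_proj_pt[lam lam0 E].
  have w0 : weight lam [ffun i => deg i] != 0 by exact: weight_neq0.
  exists (weight lam [ffun i => deg i])^-1; first by rewrite invr_eq0.
  by move=> d f Rf /=; rewrite E (section_scale _ _ Rf) exprVn mulKf // expf_neq0.
move=> z0; exists setT, (fun d => [ffun i => (d * deg i)%N]), (fun _ _ => 1); split=> //.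
- exact: (zopenT gP).
- by move=> *; exact: oner_neq0.
- move=> d _ [f Rf ->]; exists (fun z : P => f (sl (sval z))); split.
    apply: (twist_homog gP (zopenT gP)).
    exact: (multihomog_homog (section_multihomog r_gt0 rn lb Rf)).
  by move=> z _; rewrite mul1r.
Qed.

Lemma git_to_prodK p : same_pt (prod_to_git (git_to_prod p)) p.
Proof.
have [b b0 E] := git_to_prod_scale p; exists b => // d f Rf /=.
have b'0 : b^-1 != 0 by rewrite invr_eq0.
rewrite (proj_eval_slice b'0 (svalP (git_to_prod p)) _ Rf) => [|J].
  by rewrite mulrA -exprMn divff // expr1n mul1r.
by rewrite E mulKf.
Qed.

Lemma prod_to_gitK z : same_pt (git_to_prod (prod_to_git z)) z.
Proof.
apply: (veronese_inv_uniq deg_gt0); apply: (@same_pt_proj _ _ _ _ 1); first exact: oner_neq0.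
by move=> j; rewrite !mxE mul1r; exact: (esym ((sgP _).2 _)).
Qed.

Lemma git_isomorphism : is_isomorphism git_to_prod prod_to_git.
Proof.
split.
- exact: (morphism_comp git_image_morphism (veronese_inv_morphism K deg_gt0 decK)).
- exact: prod_to_git_morphism.
- exact: git_to_prodK.
- exact: prod_to_gitK.
Qed.

Lemma git_polarized :
  polarized_isomorphic (twist 1%N : line_bundle (git_quotient X))
    (twist [ffun i => deg i] : line_bundle P).
Proof.
have [u H] : {u : git_quotient X -> K & forall p, u p != 0 /\
    forall J, sv deg J (sval (git_to_prod p)) = u p * p 1%N (sg J)}.
  apply: (@choice _ _ (fun p b => b != 0 /\
    forall J, sv deg J (sval (git_to_prod p)) = b * p 1%N (sg J))) => p.
  by have [b b0 E] := git_to_prod_scale p; exists b.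
have isoP := git_isomorphism.
exists git_to_prod, prod_to_git, u; split=> //.
(* [lb_isomorphism] goes from the pullback to the bundle on the source, so the comparison scalar is
   inverted. *)
have -> : u = (fun p => ((u p)^-1)^-1) by apply: funext => p; rewrite invrK.
apply: lb_isomorphism_inv; apply: (lb_isomorphism graded_git (graded_prod_proj K m)).
- by case: isoP.
- by move=> p; rewrite invr_eq0; case: (H p).
- move=> p; have [J HJ] := proj_generated p.
  exists (fun p : git_quotient X => p 1%N (sg J)), (fun z : P => sv deg J (sval z)); split=> //.
  + apply: (twist_homog graded_git (zopenT graded_git)).
    by exists (sg J) => //; exact: (sgP J).1.
  + by apply: multihomog_homog; exact: sv_multihomog.
  + by move=> q; rewrite (H q).2 mulKf // (H q).1.
Qed.

Let gS : graded (ss_locus X) := graded_sub _ gX.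

Lemma quotient_map_morphism : is_morphism (@quotient_map K r n X).
Proof.
have secE d f (x y : subvariety X) g : R d f -> g \in unitmx ->
    sval (sval y) = g *m sval (sval x) -> f y = (\det g ^+ n) ^+ d * f x.
  by move=> [tf _] gu E; rewrite -exprM; exact: (richardson_twist_scale tf gu E).
apply: (morphism_local gS).
  move=> x y /grassmannian_pt[g gu E].
  have g0 : \det g ^+ n != 0 by rewrite expf_neq0 // -unitfE -unitmxE.
  exists (\det g ^+ n)^-1; first by rewrite invr_eq0.
  by move=> d f Rf /=; rewrite (secE _ _ _ _ _ Rf gu E) exprVn mulKf // expf_neq0.
move=> x0; exists setT, (fun d => n * d)%N, (fun _ _ => 1); split=> //.
- exact: (zopenT gS).
- by move=> *; exact: oner_neq0.
- move=> d _ [f Rf ->]; exists (fun x => f (sval x)); split.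
    exact: (twist_sub gX Rf.1).
  by move=> x _; rewrite mul1r.
Qed.

(** Degree 1 functions on the quotient pull back to the invariant sections they evaluate, so the
    comparison is [u = 1]. Near a semistable point some [sg J] does not vanish and is a frame of
    both bundles. *)
Lemma git_descent : is_descent (twist n : line_bundle (ss_locus X)) (twist 1%N).
Proof.
exists (fun=> 1); split.
  apply: (lb_isomorphism gS graded_git quotient_map_morphism).
    by move=> _; exact: oner_neq0.
  move=> x; have [z z0 [b b0 H]] := semistable_slice r_gt0 rn lb cop (svalP x).
  have [J HJ] := sv_neq0 deg z0.
  exists (fun x => sg J (sval x)), (fun p : git_quotient X => p 1%N (sg J)); split.
  - by have := twist_sub (P := @semistable K r n X) gX (sgP J).1.1; rewrite muln1.
  - by exists (sg J) => //; exact: (sgP J).1.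
  - by move=> y; rewrite mul1r.
  - by rewrite (H _ _ (sgP J).1) (sgP J).2 expr1 mulf_neq0.
move=> V s oV Ms t x y tT xy Vx Vy; rewrite !mul1r.
rewrite -[RHS]mul1r; apply: (@twist_scale _ _ (git_quotient X) 1%N V s (fun=> 1)) => //.
- by move=> _; exact: oner_neq0.
- by move=> *; rewrite mulr1.
- by move=> d _ [f Rf ->] /=; rewrite mul1r; exact: (Rf.2 t).
Qed.

End Quotient.

Theorem richardson_quotient (K : closedFieldType) (r n : nat) (l : nat -> nat) :
  (0 < r)%N -> (r < n)%N -> coprime r n ->
  (forall i, (0 < i < r)%N -> (a_ r n i.-1 + 2 <= l i <= a_ r n i)%N) ->
  let X : set (grassmannian K r n) := richardson (v_ l) (a_ r n) in
  let L : line_bundle (ss_locus X) := twist n in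
  let M : line_bundle (git_quotient X) := twist 1%N in
  let P := prod_proj K (fun i : 'I_(r - 1) => (a_ r n i.+1 - l i.+1)%N) in
  let N : line_bundle P := twist [ffun i : 'I_(r - 1) => c_ r n i.+1] in
  [/\ is_descent L M, very_ample N & polarized_isomorphic M N].
Proof.
move=> r0 rn cop lb X L M P N.
have /choice[sg sgP] := @sv_section K r n r0 rn l lb.
have [N' [dec [enc decK]]] := labels_code (@slice_dim r n l) (@slice_deg r n).
split.
- exact: git_descent cop _ sgP.
- by apply: multidegree_very_ample => i; exact: (deg_gt0 r0 rn cop i).
- exact: git_polarized cop _ sgP _ _ _ decK.
Qed.

Local Open Scope complex_scope.

Theorem theorem2p3 (R : realType) (r n : nat) (l : nat -> nat) :
  (1 <= r <= n - 1)%N -> gcdn r n = 1%N ->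
  (forall i, (1 <= i <= r - 1)%N -> (a_ r n i.-1 + 2 <= l i <= a_ r n i)%N) ->
  let X : set (grassmannian R[i] r n) := richardson (v_ l) (a_ r n) in
  let L : line_bundle (ss_locus X) := twist n in
  let M : line_bundle (git_quotient X) := twist 1%N in
  let P := prod_proj R[i] (fun i : 'I_(r - 1) => (a_ r n i.+1 - l i.+1)%N) in
  let N : line_bundle P := twist [ffun i : 'I_(r - 1) => c_ r n i.+1] in
  [/\ is_descent L M, very_ample N & polarized_isomorphic M N].
Proof.
move=> /andP[r0 rn] cop lb; apply: richardson_quotient => //; first by lia.
  exact/eqP.
by move=> i ir; apply: lb; lia.
Qed.
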